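(* Let $d\ge1$, $h>0$, $\varepsilon>0$, and let $\alpha\in\mathbb{R}^d$ be irrational. Let $v(\theta)=\sum_{|k|\le \ell}v_k e^{2\pi i k\theta}$ be a real-valued trigonometric polynomial on $\mathbb{T}$ of degree $\ell\ge 1$ (so $v_\ell\neq0$), and let $w:\mathbb{T}^d\to\mathbb{R}$ be real analytic. Denote by $\mathcal{R}$ the set of energies $E$ for which the dual cocycle $(\alpha,A_E)$ is $C_h^\omega$-diagonally reducible, that is, for which there exist $B\in C_h^\omega(\mathbb{T}^d,\mathrm{GL}(2\ell,\mathbb{C}))$ and $\rho_1,\dots,\rho_{2\ell}\in\mathbb{C}$ such that $$B(\theta+\alpha)^{-1}A_E(\theta)B(\theta)=\Lambda:=\mathrm{diag}\bigl(e^{2\pi i\rho_1},\dots,e^{2\pi i\rho_{2\ell}}\bigr)\qquad\text{for all }\theta\in\mathbb{T}^d.$$ If $E\in\mathcal{R}$ (with such $B$ and $\rho_1,\dots,\rho_{2\ell}$) and $x\in\mathbb{T}$ are such that $E$ is an eigenvalue of $H_{v,\varepsilon w,\alpha,x}$ on $\ell^2(\mathbb{Z}^d)$, then: (1) there exist $1\le j\le 2\ell$ and $k\in\mathbb{Z}^d$ such that $\rho_j-x=\langle k,\alpha\rangle \mod \mathbb{Z}$; in particular $\operatorname{Im}\rho_j=0$; (2) every corresponding eigenfunction $u\in\ell^2(\mathbb{Z}^d)$ (i.e. $H_{v,\varepsilon w,\alpha,x}u=Eu$) decays exponentially: there is a constant $C$ such that $|u_n|\le C e^{-2\pi h|n|}$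 for all $n\in\mathbb{Z}^d$.
   Context: $\mathbb{T}=\mathbb{R}/\mathbb{Z}$. ''$\alpha$ irrational'' means $\langle k,\alpha\rangle\notin\mathbb{Z}$ for all $k\in\mathbb{Z}^d\setminus\{0\}$. $|n|=|n_1|+\dots+|n_d|$ for $n\in\mathbb{Z}^d$. $C_h^\omega(\mathbb{T}^d,\cdot)$ denotes functions on $\mathbb{T}^d$ that extend to bounded analytic functions on the strip $\{\theta\in\mathbb{C}^d/\mathbb{Z}^d: |\operatorname{Im}\theta_j|<h,\ j=1,\dots,d\}$, with values in the indicated space. Fourier coefficients: $w(\theta)=\sum_{k\in\mathbb{Z}^d}w_ke^{2\pi i\langle k,\theta\rangle}$. The operator $H_{v,\varepsilon w,\alpha,x}$ acts on $\ell^2(\mathbb{Z}^d)$ by $$(H_{v,\varepsilon w,\alpha,x}u)_n=\varepsilon\sum_{k\in\mathbb{Z}^d}w_k\,u_{n+k}+v(x+\langle n,\alpha\rangle)\,u_n,\qquad n\in\mathbb{Z}^d.$$ The dual operator acts on $\ell^2(\mathbb{Z})$ by $(\hat H_{\varepsilon w,v,\alpha,\theta}u)_n=\sum_{|k|\le\ell}v_ku_{n+k}+\varepsilon w(\theta+n\alpha)u_n$, $n\in\mathbb{Z}$. The eigenvalue equation $\hat H_{\varepsilon w,v,\alpha,\theta}u=Eu$ induces the dual cocycle $(\alpha,A_E)$, where $A_E(\theta)$ is the $2\ell\times2\ell$ companion matrix whose first row is $$\Bigl(-\tfrac{v_{\ell-1}}{v_\ell},\ \dots,\ -\tfrac{v_1}{v_\ell},\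 \tfrac{E-v_0-\varepsilon w(\theta)}{v_\ell},\ -\tfrac{v_{-1}}{v_\ell},\ \dots,\ -\tfrac{v_{-\ell+1}}{v_\ell},\ -\tfrac{v_{-\ell}}{v_\ell}\Bigr)$$ (the entry containing $E$ is in column $\ell$), with entries $1$ in positions $(i+1,i)$ for $1\le i\le 2\ell-1$, and all other entries $0$. Equivalently, $A_E(\theta+n\alpha)$ maps $(u_{n+\ell-1},\dots,u_{n-\ell})^{\top}$ to $(u_{n+\ell},\dots,u_{n-\ell+1})^{\top}$ for every solution $u$ of $\hat H_{\varepsilon w,v,\alpha,\theta}u=Eu$. *)

(* Defs.v *)
From HB Require Import structures.
From mathcomp Require Import all_boot all_order all_algebra.
From mathcomp Require Import finmap complex.
From mathcomp Require Import all_classical all_reals all_analysis.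
From mathcomp Require Import summability.

Set Implicit Arguments.
Unset Strict Implicit.
Unset Printing Implicit Defensive.

Import Order.TTheory GRing.Theory Num.Theory.
Import numFieldNormedType.Exports.

Local Open Scope classical_set_scope.
Local Open Scope ring_scope.
Local Open Scope complex_scope.

(* Functions on the torus T^d = R^d / Z^d are Z^d-periodic functions of
   'rV[R]_d; points of T and T^d are given by real representatives. *)

Definition dot (K : pzRingType) (d : nat) (k : 'rV[int]_d) (x : 'rV[K]_d) : K :=
  \sum_(j < d) (k 0 j)%:~R * x 0 j.

Definition zvec (K : pzRingType) (d : nat) (k : 'rV[int]_d) : 'rV[K]_d :=
  \row_(j < d) (k 0 j)%:~R.

Definition norm1 (d : nat) (n : 'rV[int]_d) : nat := (\sum_(j < d) `|n ord0 j|)%N.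

Definition irrational_vec (R : realType) (d : nat) (alpha : 'rV[R]_d) : Prop :=
  forall k : 'rV[int]_d, k != 0 -> forall m : int, dot k alpha <> m%:~R.

(* e^{2 pi i z} *)
Definition e2pi (R : realType) (z : R[i]) : R[i] :=
  (expR (- (2 * pi * complex.Im z)))%:C *
  (cos (2 * pi * complex.Re z) +i* sin (2 * pi * complex.Re z)).

(* Unconditional (net over finite subsets) summation. *)
Definition has_sum (K : numFieldType) (I : choiceType) (a : I -> K) (s : K) :
  Prop := partial_sum a @ totally --> s.

Definition tsum (K : numFieldType) (I : choiceType) (a : I -> K) : K :=
  lim (partial_sum a @ totally).

(* f is the sum of its (multi-variable) power series in a polydisc around x;
   used with K = R (real analytic) and K = R[i] (complex analytic). *)
Definition analytic_at (K : numFieldType) (d : nat) (f : 'rV[K]_d -> K)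
    (x : 'rV[K]_d) : Prop :=
  exists (c : {ffun 'I_d -> nat} -> K) (r : K), 0 < r /\
    forall y : 'rV[K]_d, (forall j, `|y 0 j - x 0 j| < r) ->
      has_sum (fun m => c m * \prod_(j < d) (y 0 j - x 0 j) ^+ m j) (f y).

Definition real_analytic_torus (R : realType) (d : nat) (w : 'rV[R]_d -> R) :
  Prop :=
  (forall x (k : 'rV[int]_d), w (x + zvec R k) = w x) /\
  (forall x, analytic_at w x).

Definition strip (R : realType) (d : nat) (h : R) : set 'rV[R[i]]_d :=
  [set z : 'rV[R[i]]_d | forall j, `|complex.Im (z 0 j)| < h].

(* B \in C_h^omega(T^d, GL(N, C)) *)
Definition Comega_GL (R : realType) (d N : nat) (h : R)
    (B : 'rV[R]_d -> 'M[R[i]]_N) : Prop :=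
  exists Bx : 'rV[R[i]]_d -> 'M[R[i]]_N,
    [/\ forall x : 'rV[R]_d, Bx (map_mx (real_complex R) x) = B x,
        forall z, strip h z ->
          forall k : 'rV[int]_d, Bx (z + zvec R[i] k) = Bx z,
        forall z, strip h z ->
          forall i j, analytic_at (fun y => Bx y i j) z,
        exists M : R, forall z, strip h z ->
          forall i j, `|Bx z i j| <= M%:C
      & forall z, strip h z -> Bx z \in unitmx].

(* Iterated Lebesgue integral over the unit cube [0, 1]^d. *)
Fixpoint cube_integral (R : realType) (d : nat) : ('rV[R]_d -> R) -> R :=
  match d return ('rV[R]_d -> R) -> R with
  | 0 => fun f => f 0
  | d'.+1 => fun f =>
      \int[lebesgue_measure]_(t in `[0, 1])
        cube_integral (fun y : 'rV[R]_d' => f (row_mx (t%:M : 'rV_1) y))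
  end.

Definition fourier_coef (R : realType) (d : nat) (w : 'rV[R]_d -> R)
    (k : 'rV[int]_d) : R[i] :=
  let g x := (w x)%:C * e2pi (- (dot k x)%:C) in
  cube_integral (fun x => complex.Re (g x)) +i*
  cube_integral (fun x => complex.Im (g x)).

Definition trig_poly (R : realType) (l : nat) (vc : int -> R[i]) (t : R) : R[i] :=
  \sum_(j < (2 * l).+1)
    vc (j%:Z - l%:Z) * e2pi ((j%:Z - l%:Z)%:~R * t%:C).

Definition ell2 (R : realType) (d : nat) (u : 'rV[int]_d -> R[i]) : Prop :=
  (\esum_(n in [set: 'rV[int]_d]) (complex.Re (`|u n| ^+ 2))%:E < +oo)%E.

Definition Hop (R : realType) (d : nat) (v : R -> R) (eps : R)
    (w : 'rV[R]_d -> R) (alpha : 'rV[R]_d) (x : R)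
    (u : 'rV[int]_d -> R[i]) (n : 'rV[int]_d) : R[i] :=
  eps%:C * tsum (fun k : 'rV[int]_d => fourier_coef w k * u (n + k))
  + (v (x + dot n alpha))%:C * u n.

Definition eigenfunction (R : realType) (d : nat) (v : R -> R) (eps : R)
    (w : 'rV[R]_d -> R) (alpha : 'rV[R]_d) (x : R) (E : R[i])
    (u : 'rV[int]_d -> R[i]) : Prop :=
  ell2 u /\ (forall n, Hop v eps w alpha x u n = E * u n).

Definition eigenvalue_of (R : realType) (d : nat) (v : R -> R) (eps : R)
    (w : 'rV[R]_d -> R) (alpha : 'rV[R]_d) (x : R) (E : R[i]) : Prop :=
  exists u, eigenfunction v eps w alpha x E u /\ exists n, u n != 0.

(* Indices are shifted by one: column j here is column j.+1 of the usual
   numbering, so that E sits in column j = l.-1. *)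
Definition dual_cocycle (R : realType) (d l : nat) (vc : int -> R[i]) (eps : R)
    (w : 'rV[R]_d -> R) (E : R[i]) (theta : 'rV[R]_d) : 'M[R[i]]_(2 * l) :=
  \matrix_(i, j)
    if i == 0%N :> nat then
      (if j.+1 == l then E - vc 0 - eps%:C * (w theta)%:C
       else - vc (l%:Z - j.+1%:Z)) / vc l%:Z
    else (i == j.+1 :> nat)%:R.

Definition diagonally_reduces (R : realType) (d N : nat) (h : R)
    (alpha : 'rV[R]_d) (A : 'rV[R]_d -> 'M[R[i]]_N)
    (B : 'rV[R]_d -> 'M[R[i]]_N) (rho : 'I_N -> R[i]) : Prop :=
  Comega_GL h B /\
  forall theta, invmx (B (theta + alpha)) *m A theta *m B theta =
    diag_mx (\row_(j < N) e2pi (rho j)).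

(* Main.v *)
Require Import Defs.
From mathcomp Require Import all_boot all_order all_algebra.
From mathcomp Require Import finmap complex.
From mathcomp Require Import all_classical all_reals all_analysis.
From mathcomp Require Import summability ring lra zify.

(** The theorem is Aubry duality. Put [g = sum_n conj (u n) chi n], where [chi n]
    is the character [x |-> e^{2 pi i <n, x>}] of the torus. The eigenvalue
    equation on the lattice, conjugated, says that
      [sum_k v_k e^{2 pi i k x} g (theta + k alpha) + eps w g = E g],
    with [E] real because the operator is symmetric ([eigenvalue_real]). Hence the
    vector of the translates of [g], with its phases, is an equivariant section
    of the dual cocycle with multiplier [e^{2 pi i x}] ([cocycle_equation]). In
    the frame [B] the cocycle is the constant diagonal matrix, so each component
    [y_j] of this section satisfies
      [e^{2 pi i x} y_j (theta + alpha) = e^{2 pi i rho_j} y_j (theta)].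
    A Fourier coefficient of [y_j] at a frequency [k] therefore vanishes unless
    [rho_j - x - <k, alpha>] is an integer; as [alpha] is irrational, at most one
    frequency survives and [y_j] is a multiple of one character
    ([reduced_monochromatic]). Some [y_j] is not zero, which is the resonance
    (1). Returning to the original frame, [g] is a finite combination of entries
    of [B] times characters ([eigenfunction_expansion]), so the coefficients [u n]
    decay like the Fourier coefficients of [B], which is (2).

    Since [g] is only square integrable, it is handled as the functional
    [f |-> integral of f g] ([pairing]) on an algebra of Lipschitz periodic
    functions ([regular]) that contains [w] and the entries of [B] and of its
    inverse. Such functionals are bounded for the sup norm, and two of them that
    agree on characters coincide ([bfun_eq]), by uniform density of trigonometric
    polynomials ([trig_dense]); each identity above is thus verified on characters,
    where it is the equation on the lattice. Density is proved with Korovkin's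
    argument for a product of powers of cosines.

    The decay rate ([fourier_decay]) comes from moving the torus of integration
    inside the strip. A real translation multiplies a Fourier coefficient by a
    character; the Cauchy-Riemann equation converts this into an exponential for
    an imaginary translation ([mean_transport]), with an error of second order in
    the step which disappears after subdivision. The uniform second order bound is
    read off the power series ([has_series_local_bounds]) and made uniform by
    compactness ([cube_uniform]). *)

Set Implicit Arguments.
Unset Strict Implicit.
Unset Printing Implicit Defensive.

Import Order.TTheory GRing.Theory Num.Theory.
Import numFieldNormedType.Exports.

Local Open Scope classical_set_scope.
Local Open Scope ring_scope.
Local Open Scope complex_scope.

(** * The modulus of complex numbers and unconditional sums *)

Section Modulus.
Variable R : realType.
Implicit Types z u : R[i].

Definition nm z : R := Normc.normc z.

Lemma normr_nm z : `|z| = (nm z)%:C.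
Proof. by case: z. Qed.

Lemma complex_inj_real (x y : R) : x%:C = y%:C :> R[i] -> x = y.
Proof. by case. Qed.

Lemma le_real_complex (x y : R) : (x%:C <= y%:C :> R[i]) = (x <= y).
Proof. exact: lecR. Qed.

Lemma nmM z u : nm (z * u) = nm z * nm u.
Proof. by apply: complex_inj_real; rewrite rmorphM /= -!normr_nm normrM. Qed.

Lemma nmD z u : nm (z + u) <= nm z + nm u.
Proof. by rewrite -le_real_complex rmorphD /= -!normr_nm ler_normD. Qed.

Lemma nm0 : nm 0 = 0.
Proof. by apply: complex_inj_real; rewrite -normr_nm normr0. Qed.

Lemma nm1 : nm 1 = 1.
Proof. by apply: complex_inj_real; rewrite -normr_nm normr1. Qed.

Lemma nmN z : nm (- z) = nm z.
Proof. by apply: complex_inj_real; rewrite -!normr_nm normrN. Qed.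

Lemma nmB z u : nm (z - u) = nm (u - z).
Proof. by rewrite -opprB nmN. Qed.

Lemma nm_ge0 z : 0 <= nm z.
Proof. by rewrite -le_real_complex -normr_nm normr_ge0. Qed.

Lemma nm_eq0 z : (nm z == 0) = (z == 0).
Proof.
apply/eqP/eqP => [h|->]; last exact: nm0.
by apply/normr0_eq0; rewrite normr_nm h.
Qed.

Lemma nmX z n : nm (z ^+ n) = nm z ^+ n.
Proof. by elim: n => [|n IH]; rewrite ?nm1 // !exprS nmM IH. Qed.

Lemma nmV z : nm z^-1 = (nm z)^-1.
Proof. by apply: complex_inj_real; rewrite fmorphV /= -!normr_nm normfV. Qed.

Lemma nmC (x : R) : nm x%:C = `|x|.
Proof. by rewrite /nm /= expr0n addr0 sqrtr_sqr. Qed.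

Lemma nm_sum (I : Type) (r : seq I) (P : pred I) (F : I -> R[i]) :
  nm (\sum_(i <- r | P i) F i) <= \sum_(i <- r | P i) nm (F i).
Proof.
elim/big_rec2: _ => [|i y x _ h]; first by rewrite nm0.
by rewrite (le_trans (nmD _ _))// lerD2l.
Qed.

Lemma nm_prod (I : Type) (r : seq I) (P : pred I) (F : I -> R[i]) :
  nm (\prod_(i <- r | P i) F i) = \prod_(i <- r | P i) nm (F i).
Proof. exact: (big_morph nm nmM nm1). Qed.

Lemma nm_sqr z : nm z ^+ 2 = complex.Re z ^+ 2 + complex.Im z ^+ 2.
Proof. by case: z => a b; rewrite /nm /= sqr_sqrtr ?addr_ge0 ?sqr_ge0. Qed.

Lemma nm_conj z : nm (conjc z) = nm z.
Proof. by case: z => a b; rewrite /nm /= sqrrN. Qed.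

Lemma mul_conj z : z * conjc z = (nm z ^+ 2)%:C.
Proof.
rewrite nm_sqr; case: z => a b; apply/eqP; rewrite eq_complex /=.
by apply/andP; split; apply/eqP; ring.
Qed.

Lemma Re_le_nm z : `|complex.Re z| <= nm z.
Proof.
rewrite -(@ler_pXn2r _ 2) ?nnegrE ?nm_ge0 ?normr_ge0//.
by rewrite nm_sqr real_normK ?num_real// lerDl sqr_ge0.
Qed.

Lemma Im_le_nm z : `|complex.Im z| <= nm z.
Proof.
rewrite -(@ler_pXn2r _ 2) ?nnegrE ?nm_ge0 ?normr_ge0//.
by rewrite nm_sqr real_normK ?num_real// lerDr sqr_ge0.
Qed.

Lemma complexRI z : z = (complex.Re z)%:C + 'i * (complex.Im z)%:C.
Proof.
case: z => a b; apply/eqP; rewrite eq_complex /=.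
by apply/andP; split; apply/eqP; ring.
Qed.

Lemma nmi : nm 'i = 1.
Proof. by rewrite /nm /= expr0n expr1n add0r sqrtr1. Qed.

Lemma nm_le_ReIm z : nm z <= `|complex.Re z| + `|complex.Im z|.
Proof. by rewrite {1}(complexRI z) (le_trans (nmD _ _))// nmM !nmC nmi mul1r. Qed.

Lemma nm_tri z u t : nm (z - t) <= nm (z - u) + nm (u - t).
Proof. by rewrite -(subrKA u) nmD. Qed.

(** A unimodular factor turns a bound on real parts into a bound on moduli. *)
Lemma exists_phase z : exists c : R[i], nm c = 1 /\ c * z = (nm z)%:C.
Proof.
have [->|z0] := eqVneq z 0; first by exists 1; rewrite nm1 nm0 mulr0.
have nz : nm z != 0 by rewrite nm_eq0.
exists (conjc z / (nm z)%:C); split.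
  by rewrite nmM nm_conj nmV nmC ger0_norm ?nm_ge0// divff.
rewrite mulrAC [_ * z]mulrC mul_conj rmorphXn /= expr2 mulfK//.
by apply: contra nz => /eqP[->].
Qed.

End Modulus.

Arguments nm {R} : simpl never.

Section Summation.

Local Existing Instance totally_filter.

Lemma has_sum_norm (K : numFieldType) (I : choiceType) (a : I -> K) (s : K) :
  has_sum a s <-> forall e, 0 < e -> exists J0 : {fset I}, forall J : {fset I},
    (J0 `<=` J)%fset -> `|s - \sum_(i <- J) a i| <= e.
Proof.
rewrite /has_sum; split.
  move/cvgrPdist_le => h e e0; have [J0 _ hJ] := h e e0.
  by exists J0 => J sJ; have := hJ J sJ; rewrite /partial_sum big_seq_fsetE.
move=> h; apply/cvgrPdist_le => e e0; have [J0 hJ] := h e e0.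
by exists J0 => // J sJ; have := hJ J sJ; rewrite /= /partial_sum big_seq_fsetE.
Qed.

Lemma tsumE (K : numFieldType) (I : choiceType) (a : I -> K) (s : K) :
  has_sum a s -> tsum a = s.
Proof. by move=> h; apply: cvg_lim h; exact: norm_hausdorff. Qed.

Lemma has_sum_nm (R : realType) (I : choiceType) (a : I -> R[i]) (s : R[i]) :
  has_sum a s <-> forall e : R, 0 < e -> exists J0 : {fset I},
    forall J : {fset I}, (J0 `<=` J)%fset -> nm (\sum_(i <- J) a i - s) <= e.
Proof.
rewrite has_sum_norm; split => h e e0.
  have [|J0 hJ] := h e%:C; first by rewrite ltcR.
  by exists J0 => J sJ; rewrite nmB -le_real_complex -normr_nm hJ.
have eE : e = (complex.Re e)%:C by case: e e0 => a0 b0 /=; rewrite ltcE /= => /andP[/eqP ->].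
have [|J0 hJ] := h (complex.Re e); first by rewrite -ltcR -eE.
by exists J0 => J sJ; rewrite eE normr_nm le_real_complex nmB hJ.
Qed.

Lemma sum_fsetID (V : nmodType) (I : choiceType) (A B : {fset I}) (F : I -> V) :
  \sum_(i <- A) F i =
  \sum_(i <- (A `&` B)%fset) F i + \sum_(i <- (A `\` B)%fset) F i.
Proof.
rewrite (big_fsetID _ (mem B)) /=.
congr (_ + _); apply: eq_fbigl => i; rewrite !inE //=.
by rewrite andbC.
Qed.

Lemma sum_fsetU (V : nmodType) (I : choiceType) (A B : {fset I}) (F : I -> V) :
  [disjoint A & B]%fset -> \sum_(i <- (A `|` B)%fset) F i =
  \sum_(i <- A) F i + \sum_(i <- B) F i.
Proof.
move=> dAB; rewrite (sum_fsetID _ A).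
congr (_ + _); apply: eq_fbigl => i; rewrite !inE.
  by case: (i \in A); rewrite ?andbF.
have := fdisjointP dAB i; case: (i \in A) => //= /(_ isT)/negbTE ->.
by [].
Qed.

End Summation.

(** * The exponential on the circle *)

Section Exponential.
Variable R : realType.
Implicit Types (z u : R[i]) (s t a : R).

Lemma e2piD z u : e2pi (z + u) = e2pi z * e2pi u.
Proof.
case: z => a b; case: u => c d; rewrite /e2pi /=.
rewrite !mulrDr opprD expRD cosD sinD.
by apply/eqP; rewrite eq_complex /=; apply/andP; split; apply/eqP; ring.
Qed.

Lemma e2pi0 : e2pi (0 : R[i]) = 1.
Proof. by rewrite /e2pi /= !mulr0 oppr0 expR0 cos0 sin0 mul1r. Qed.

Definition ee t : R[i] := e2pi t%:C.

Lemma eeE t : ee t = cos (2 * pi * t) +i* sin (2 * pi * t).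
Proof. by rewrite /ee /e2pi /= mulr0 oppr0 expR0 mul1r. Qed.

Lemma eeD s t : ee (s + t) = ee s * ee t.
Proof. by rewrite /ee rmorphD e2piD. Qed.

Lemma ee0 : ee 0 = 1. Proof. exact: e2pi0. Qed.

Lemma nm_e2pi z : nm (e2pi z) = expR (- (2 * pi * complex.Im z)).
Proof.
rewrite /e2pi nmM nmC ger0_norm ?expR_ge0//.
by rewrite /nm /= cos2Dsin2 sqrtr1 mulr1.
Qed.

Lemma nm_ee t : nm (ee t) = 1.
Proof. by rewrite /ee nm_e2pi /= mulr0 oppr0 expR0. Qed.

Lemma ee_neq0 t : ee t != 0.
Proof. by rewrite -nm_eq0 nm_ee oner_neq0. Qed.

Lemma eeN t : ee (- t) = conjc (ee t).
Proof. by rewrite !eeE mulrN cosN sinN. Qed.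

Lemma eeNV t : ee (- t) = (ee t)^-1.
Proof.
by apply: (mulIf (ee_neq0 t)); rewrite -eeD addNr ee0 mulVf ?ee_neq0.
Qed.

Lemma ee_nat (n : nat) : ee n%:R = 1.
Proof.
elim: n => [|n IH]; first exact: ee0.
rewrite -natr1 eeD IH mul1r eeE mulr1 mulr_natl cos2pi sin2pi.
by apply/eqP; rewrite eq_complex /= !eqxx.
Qed.

Lemma ee_int (m : int) : ee m%:~R = 1.
Proof.
case: m => n; first exact: ee_nat.
by rewrite NegzE mulrNz eeNV ee_nat invr1.
Qed.

Lemma eeX t (n : nat) : ee t ^+ n = ee (n%:R * t).
Proof.
elim: n => [|n IH]; first by rewrite mul0r ee0.
by rewrite exprS IH -eeD -natr1 mulrDl mul1r addrC.
Qed.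

Lemma ee_sum (I : Type) (r : seq I) (P : pred I) (F : I -> R) :
  ee (\sum_(i <- r | P i) F i) = \prod_(i <- r | P i) ee (F i).
Proof. exact: (big_morph ee eeD ee0). Qed.

Lemma abs_sin_le a : `|sin a| <= `|a|.
Proof.
have pos (b : R) : 0 < b -> `|sin b| <= b.
  move=> b0; have [|c _] := @MVT R (@sin R) (@cos R) 0 b b0.
    by apply: continuous_subspaceT => x; exact: continuous_sin.
  rewrite sin0 !subr0 => ->; rewrite normrM (gtr0_norm b0).
  by rewrite ler_piMl ?cos_max ?ltW.
have [a0|a0|<-] := ltgtP 0 a; last by rewrite sin0.
  by rewrite (gtr0_norm a0); exact: pos.
have a0' : 0 < - a by rewrite oppr_gt0.
by rewrite -(normrN (sin a)) -sinN -(normrN a) (gtr0_norm a0'); exact: pos.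
Qed.

Lemma one_sub_cos a : 1 - cos a = 2 * sin (a / 2) ^+ 2.
Proof.
rewrite -{1}(divfK (_ : 2 != 0 :> R) a) ?pnatr_eq0// mulr_natr cos_mulr2n.
by rewrite cos2sin2; ring.
Qed.

Lemma one_sub_cos_le a : 0 <= 1 - cos a <= a ^+ 2 / 2.
Proof.
have := cos_le1 a; rewrite {2}one_sub_cos => h.
rewrite subr_ge0 h /=.
have h1 : sin (a / 2) ^+ 2 <= (a / 2) ^+ 2.
  by rewrite -(real_normK (num_real (sin _))) -(real_normK (num_real (_ / _)))
    lerXn2r ?nnegrE ?normr_ge0// abs_sin_le.
lra.
Qed.

Lemma sin_sub_le a : `|a| <= 1 -> `|a - sin a| <= a ^+ 2.
Proof.
have pos (b : R) : 0 < b <= 1 -> `|b - sin b| <= b ^+ 2.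
  move=> /andP[b0 b1]; have [|c cb] := @MVT R (@sin R) (@cos R) 0 b b0.
    by apply: continuous_subspaceT => x; exact: continuous_sin.
  rewrite sin0 !subr0 => ->; rewrite -{1}(mul1r b) -mulrBl normrM (gtr0_norm b0).
  have /andP[h0 h1] := one_sub_cos_le c.
  rewrite ger0_norm// expr2 (ler_wpM2r (ltW b0))// (le_trans h1)//.
  move: cb; rewrite in_itv /= => /andP[c0 cb]; nra.
move=> a1; have [a0|a0|<-] := ltgtP 0 a.
- by apply: pos; rewrite a0 -(gtr0_norm a0).
- rewrite -(normrN (a - _)) opprD -sinN -sqrrN; apply: pos.
  by rewrite oppr_gt0 a0 -(ltr0_norm a0).
- by rewrite sin0 subrr normr0 expr0n.
Qed.

Lemma nm_ee_sub1 t : nm (ee t - 1) ^+ 2 = 2 * (1 - cos (2 * pi * t)).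
Proof. by rewrite nm_sqr eeE /= subr0 sin2cos2; ring. Qed.

Lemma nm_ee_sub1_le t : nm (ee t - 1) <= 2 * pi * `|t|.
Proof.
rewrite -(@ler_pXn2r _ 2) ?nnegrE ?nm_ge0 ?mulr_ge0 ?pi_ge0//.
rewrite nm_ee_sub1 exprMn real_normK ?num_real// -exprMn.
by have /andP[_] := one_sub_cos_le (2 * pi * t); lra.
Qed.

Lemma nm_ee_sub s t : nm (ee s - ee t) <= 2 * pi * `|s - t|.
Proof.
have -> : ee s - ee t = (ee (s - t) - 1) * ee t.
  by rewrite mulrBl -eeD subrK mul1r.
by rewrite nmM nm_ee mulr1 nm_ee_sub1_le.
Qed.

Lemma ee_sub1_ge (d r : R) : 0 < d -> d <= `|r| <= 1 / 2 ->
  2 * (1 - cos (2 * pi * d)) <= nm (ee r - 1) ^+ 2.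
Proof.
move=> d0 /andP[dr r1]; rewrite nm_ee_sub1 ler_pM2l ?ltr0n// lerD2l lerN2.
have p0 := pi_gt0 R.
rewrite -(cos_norm (2 * pi * r)) (normrM (2 * pi)).
rewrite (gtr0_norm (_ : 0 < 2 * pi :> R)) ?mulr_gt0//.
have ind : 2 * pi * d \in `[0, pi].
  by rewrite in_itv /=; apply/andP; split; nra.
have inr : 2 * pi * `|r| \in `[0, pi].
  by rewrite in_itv /=; apply/andP; split; nra.
by rewrite leNgt (ltr_cos inr ind) -leNgt; nra.
Qed.

Lemma one_sub_cos_gt0 (d : R) : 0 < d <= 1 / 2 -> 0 < 1 - cos (2 * pi * d).
Proof.
move=> /andP[d0 d1]; have p0 := pi_gt0 R; rewrite subr_gt0 -[ltRHS](@cos0 R).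
have in0 : (0 : R) \in `[0, pi] by rewrite in_itv /= lexx ltW.
have ind : 2 * pi * d \in `[0, pi].
  by rewrite in_itv /=; apply/andP; split; nra.
by rewrite (ltr_cos in0 ind); nra.
Qed.

Lemma ee_eq1 t : ee t = 1 -> exists m : int, t = m%:~R.
Proof.
move=> h; set m := Num.floor t; exists m.
have /andP[lo hi] := floor_itv t.
set r := t - m%:~R.
have hr : ee r = 1 by rewrite /r eeD h mul1r -mulrNz ee_int.
have r0 : 0 <= r by rewrite subr_ge0.
have r1 : r < 1 by rewrite ltrBlDr addrC; move: hi; rewrite intrD.
have key (d : R) : 0 < d <= 1 / 2 -> ee d != 1.
  move=> dd; apply/eqP => e; have := one_sub_cos_gt0 dd.
  have := nm_ee_sub1 d; rewrite e subrr nm0 expr0n /= => /esym/eqP.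
  by rewrite mulf_eq0 pnatr_eq0 /= => /eqP ->; rewrite ltxx.
have [r00|rn0] := eqVneq r 0; first by apply/eqP; rewrite -subr_eq0; apply/eqP.
have rp : 0 < r by rewrite lt_def rn0.
have [rh|rh] := leP r (1 / 2); first by move: (key r); rewrite rp rh hr eqxx => /(_ isT).
have : ee (1 - r) != 1 by apply: key; lra.
by rewrite eeD eeNV hr invr1 mulr1 (ee_nat 1) eqxx.
Qed.

Lemma e2pi_eq1 z : e2pi z = 1 -> exists m : int, z = m%:~R.
Proof.
move=> h; have := nm_e2pi z; rewrite h nm1 -[X in X = _](@expR0 R) => /expR_inj/esym/eqP.
rewrite oppr_eq0 !mulf_eq0 pnatr_eq0 /= gt_eqF ?pi_gt0//= => /eqP im0.
have zE : z = (complex.Re z)%:C by case: z im0 {h} => a b /= ->.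
by move: h; rewrite zE => /ee_eq1[m ->]; exists m; rewrite rmorph_int.
Qed.

End Exponential.

Arguments ee {R} : simpl never.
Arguments e2pi {R} : simpl never.

(** * Iterated integrals over the cube *)

Section CubeIntegral.
Variable R : realType.

Definition sup_close d (e : R) (x y : 'rV[R]_d) := forall j, `|x 0 j - y 0 j| <= e.

Definition real_lipschitz d (f : 'rV[R]_d -> R) := exists2 C : R, 0 <= C &
  forall x y e, 0 <= e -> sup_close e x y -> `|f x - f y| <= C * e.

Lemma real_lipschitz_cst d (c : R) : real_lipschitz (fun=> c : R) (d := d).
Proof. by exists 0 => // x y e _ _; rewrite subrr normr0 mul0r. Qed.

Lemma real_lipschitzD d (f g : 'rV[R]_d -> R) :
  real_lipschitz f -> real_lipschitz g -> real_lipschitz (fun x => f x + g x).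
Proof.
move=> [C C0 hC] [D D0 hD]; exists (C + D); first by rewrite addr_ge0.
move=> x y e e0 xy; rewrite opprD addrACA mulrDl.
by rewrite (le_trans (ler_normD _ _))// lerD ?hC ?hD.
Qed.

Lemma real_lipschitzZ d (c : R) (f : 'rV[R]_d -> R) :
  real_lipschitz f -> real_lipschitz (fun x => c * f x).
Proof.
move=> [C C0 hC]; exists (`|c| * C); first by rewrite mulr_ge0.
by move=> x y e e0 xy; rewrite -mulrBr normrM -mulrA ler_wpM2l ?hC.
Qed.

Definition slice d (t : R) (f : 'rV[R]_d.+1 -> R) : 'rV[R]_d -> R :=
  fun y => f (row_mx (t%:M : 'rV_1) y).

Lemma real_lipschitz_slice d (f : 'rV[R]_d.+1 -> R) t :
  real_lipschitz f -> real_lipschitz (slice t f).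
Proof.
move=> [C C0 hC]; exists C => // x y e e0 xy; apply: hC => // j.
rewrite !mxE; case: splitP => k _; last exact: xy.
by rewrite !mxE subrr normr0.
Qed.

Lemma slice_lip d (f : 'rV[R]_d.+1 -> R) : real_lipschitz f -> exists2 C : R, 0 <= C &
  forall s t y, `|slice s f y - slice t f y| <= C * `|s - t|.
Proof.
move=> [C C0 hC]; exists C => // s t y; apply: hC => // j.
rewrite !mxE; case: splitP => k _; last by rewrite subrr normr0.
by rewrite !mxE !ord1 eqxx.
Qed.

Let mu := @lebesgue_measure R.
Let I01 : set R := `[0, 1]%classic.

Lemma lip_integrable (F : R -> R) (C : R) :
  (forall s t, `|F s - F t| <= C * `|s - t|) -> mu.-integrable I01 (EFin \o F).
Proof.
move=> hF; apply: continuous_compact_integrable; first exact: segment_compact.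
apply: continuous_subspaceT => t; apply/cvgrPdist_le => e e0.
have C1 : 0 < `|C| + 1 by rewrite ltr_wpDl.
near=> s; apply: (le_trans (hF _ _)).
have st : `|t - s| <= e / (`|C| + 1).
  near: s; apply: (@cvgr_dist_le _ _ _ (nbhs t) _ id t) => //.
  by rewrite divr_gt0.
rewrite -(divfK (lt0r_neq0 C1) e).
apply: (@le_trans _ _ (`|C| * `|t - s|)); first by rewrite ler_wpM2r ?ler_norm.
by rewrite mulrC ler_pM// lerDl.
Unshelve. all: by end_near. Qed.

(** All four rules are proved at once, because integrability of a slice
    integral as a function of its parameter rests on monotonicity in one
    dimension less. *)
Lemma cube_rules d :
  [/\ forall f g : 'rV[R]_d -> R, real_lipschitz f -> real_lipschitz g ->
        cube_integral (fun x => f x + g x) = cube_integral f + cube_integral g,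
      forall (c : R) (f : 'rV[R]_d -> R), real_lipschitz f ->
        cube_integral (fun x => c * f x) = c * cube_integral f,
      forall f g : 'rV[R]_d -> R, real_lipschitz f -> real_lipschitz g ->
        (forall x, f x <= g x) ->
        cube_integral f <= cube_integral g
    & forall c : R, cube_integral (fun _ : 'rV[R]_d => c) = c].
Proof.
elim: d => [|d [hD hZ hm hc]]; first by split => //=.
have intble f : real_lipschitz f ->
    mu.-integrable I01 (EFin \o (fun t => cube_integral (slice (d := d) t f))).
  move=> lf; have [C C0 hC] := slice_lip lf; apply: (@lip_integrable _ C).
  have half s t : cube_integral (slice s f) - cube_integral (slice t f)
      <= C * `|s - t|.
    rewrite lerBlDl -[X in _ + X](hc (C * `|s - t|)) -hD.
    - apply: hm => [||y]; first exact: real_lipschitz_slice.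
        by apply: real_lipschitzD; [exact: real_lipschitz_slice|exact: real_lipschitz_cst].
      by rewrite -lerBlDl; apply: le_trans (hC s t y); exact: ler_norm.
    - exact: real_lipschitz_slice.
    - exact: real_lipschitz_cst.
  by move=> s t; rewrite ler_norml half andbT lerNl opprB distrC half.
have mI : measurable I01 by exact: measurable_itv.
split => [f g lf lg|c f lf|f g lf lg fg|c] /=.
- rewrite -RintegralD//; try exact: intble.
  by apply: eq_Rintegral => t _; apply: hD; exact: real_lipschitz_slice.
- rewrite -RintegralZl//; try exact: intble.
  by apply: eq_Rintegral => t _; apply: hZ; exact: real_lipschitz_slice.
- apply: le_Rintegral => //; try exact: intble.
  by move=> t _; apply: hm => [||y]; [exact: real_lipschitz_slice..|exact: fg].
- under eq_Rintegral do rewrite hc.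
  rewrite Rintegral_cst//.
  have h : lebesgue_measure [set` `[0, 1]] = (1 : R)%:E.
    by rewrite lebesgue_measure_itv /= lte_fin ltr01 oppr0 adde0.
  rewrite -[RHS]mulr1; congr (_ * _).
  exact: (congr1 fine h).
Qed.

End CubeIntegral.

(** * Integrals of trigonometric functions *)

Section TrigIntegral.
Variable R : realType.

Lemma is_derive_trig (a b w t : R) :
  is_derive t 1 (fun s : R => a * sin (w * s) + b * cos (w * s))
    (w * (a * cos (w * t) - b * sin (w * t))).
Proof.
have dw : is_derive t 1 (fun s : R => w * s) w.
  have -> : (fun s : R => w * s) = w \*: @id R by [].
  by apply: is_derive_eq; rewrite /GRing.scale /= mulr1.
have ds : is_derive t 1 (fun s : R => sin (w * s)) (cos (w * t) * w).
  exact: (@is_derive1_comp R sin (fun s => w * s)).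
have dc : is_derive t 1 (fun s : R => cos (w * s)) (- sin (w * t) * w).
  exact: (@is_derive1_comp R cos (fun s => w * s)).
have -> : (fun s : R => a * sin (w * s) + b * cos (w * s)) =
  (a \*: (fun s : R => sin (w * s))) + (b \*: (fun s : R => cos (w * s))) by [].
by apply: is_derive_eq; rewrite /GRing.scale /=; ring.
Qed.

Lemma continuous_trig (a b w : R) :
  continuous (fun s : R => a * sin (w * s) + b * cos (w * s)).
Proof.
move=> t; apply: differentiable_continuous; apply/derivable1_diffP.
by have [] := is_derive_trig a b w t.
Qed.

Lemma integral_trig (a b : R) (n : int) : n != 0 ->
  \int[lebesgue_measure]_(t in `[0, 1])
    (a * cos (2 * pi * (n%:~R * t)) - b * sin (2 * pi * (n%:~R * t))) = 0 :> R.
Proof.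
move=> n0; set w : R := 2 * pi * n%:~R.
have w0 : w != 0.
  by rewrite !mulf_neq0 ?pnatr_eq0 ?intr_eq0// gt_eqF// pi_gt0.
pose F (s : R) : R := (a / w) * sin (w * s) + (b / w) * cos (w * s).
pose f (s : R) : R := (- b) * sin (w * s) + a * cos (w * s).
have dF (t : R) : is_derive t 1 F (f t).
  apply: (is_derive_eq (is_derive_trig (a / w) (b / w) w t)).
  by rewrite /f; field.
have cF : continuous F by exact: continuous_trig.
have -> : (fun t : R => a * cos (2 * pi * (n%:~R * t))
    - b * sin (2 * pi * (n%:~R * t))) = f.
  apply/funext => t; have -> : 2 * pi * (n%:~R * t) = w * t by rewrite /w mulrA.
  by rewrite /f; ring.
have fE : F 1 = F 0.
  rewrite /F !mulr0 !mulr1 sin0 cos0.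
  have := ee_int R n; rewrite eeE => /eqP.
  by rewrite eq_complex /= => /andP[/eqP -> /eqP ->].
rewrite /Rintegral (@continuous_FTC2 _ f F)//.
- by rewrite fE -EFinB subrr.
- by apply: continuous_subspaceT; exact: continuous_trig.
- split => [t _||]; first by have [] := dF t.
    by apply: cvg_at_right_filter; exact: cF.
  by apply: cvg_at_left_filter; exact: cF.
- by move=> t _; rewrite derive1E; have [_] := dF t.
Qed.

End TrigIntegral.

(** * Regular functions on the torus and their averages *)

Section Regular.
Variable R : realType.

Section Dot.
Variable d : nat.
Implicit Types (k n : 'rV[int]_d) (x y : 'rV[R]_d).

Lemma dotDr k x y : dot k (x + y) = dot k x + dot k y.
Proof. by rewrite /dot -big_split; apply: eq_bigr => j _; rewrite mxE mulrDr. Qed.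

Lemma dotNr k x : dot k (- x) = - dot k x.
Proof. by rewrite /dot -sumrN; apply: eq_bigr => j _; rewrite mxE mulrN. Qed.

Lemma dotZr k x (c : R) : dot k (c *: x) = c * dot k x.
Proof. by rewrite /dot mulr_sumr; apply: eq_bigr => j _; rewrite mxE mulrCA. Qed.

Lemma dotDl k n x : dot (k + n) x = dot k x + dot n x.
Proof.
by rewrite /dot -big_split; apply: eq_bigr => j _; rewrite mxE intrD mulrDl.
Qed.

Lemma dotNl k x : dot (- k) x = - dot k x.
Proof.
by rewrite /dot -sumrN; apply: eq_bigr => j _; rewrite mxE mulrNz mulNr.
Qed.

Lemma dot0l x : dot 0 x = 0 :> R.
Proof. by rewrite /dot big1// => j _; rewrite mxE mul0r. Qed.

Lemma dot_zvec k n : exists m : int, dot k (zvec R n) = m%:~R.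
Proof.
exists (\sum_(j < d) k 0 j * n 0 j); rewrite rmorph_sum /=.
by apply: eq_bigr => j _; rewrite mxE intrM.
Qed.

Lemma norm1_sum k : (norm1 k)%:R = \sum_j `|k 0 j|%:~R :> R.
Proof.
by rewrite /norm1 natr_sum; apply: eq_bigr => j _; rewrite -abszE.
Qed.

Lemma dot_le k x (e : R) : (forall j, `|x 0 j| <= e) ->
  `|dot k x| <= (norm1 k)%:R * e.
Proof.
move=> h; rewrite norm1_sum mulr_suml (le_trans (ler_norm_sum _ _ _))//.
by apply: ler_sum => j _; rewrite normrM intr_norm ler_wpM2l.
Qed.

Lemma norm1D k n : (norm1 (k + n) <= norm1 k + norm1 n)%N.
Proof.
rewrite /norm1 -big_split /=; apply: leq_sum => j _; rewrite mxE.
by have := ler_normD (k 0 j) (n 0 j); rewrite -!abszE -PoszD lez_nat.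
Qed.

End Dot.

Definition lipschitz_fun d (f : 'rV[R]_d -> R[i]) := exists2 C : R, 0 <= C &
  forall x y e, 0 <= e -> sup_close e x y -> nm (f x - f y) <= C * e.

(** A convenient algebra of functions on the torus: large enough to contain
    the cocycle and its conjugacy, small enough that every member is
    integrable and a uniform limit of trigonometric polynomials. *)
Definition regular d (f : 'rV[R]_d -> R[i]) :=
  [/\ forall x k, f (x + zvec R k) = f x,
      exists C : R, forall x, nm (f x) <= C & lipschitz_fun f].

Section Algebra.
Variable d : nat.
Implicit Types f g : 'rV[R]_d -> R[i].

Lemma regular_cst (c : R[i]) : regular (fun _ : 'rV[R]_d => c).
Proof.
split=> //; first by exists (nm c).
by exists 0 => // x y e _ _; rewrite subrr nm0 mul0r.
Qed.

Lemma regularD f g : regular f -> regular g -> regular (fun x => f x + g x).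
Proof.
move=> [pf [A hA] [C C0 hC]] [pg [B hB] [D D0 hD]]; split.
- by move=> x k; rewrite pf pg.
- by exists (A + B) => x; rewrite (le_trans (nmD _ _))// lerD.
- exists (C + D); first by rewrite addr_ge0.
  move=> x y e e0 xy; rewrite opprD addrACA mulrDl.
  by rewrite (le_trans (nmD _ _))// lerD ?hC ?hD.
Qed.

Lemma regularM f g : regular f -> regular g -> regular (fun x => f x * g x).
Proof.
move=> [pf [A hA] [C C0 hC]] [pg [B hB] [D D0 hD]]; split.
- by move=> x k; rewrite pf pg.
- by exists (A * B) => x; rewrite nmM ler_pM ?nm_ge0.
have A0 : 0 <= A := le_trans (nm_ge0 _) (hA 0).
have B0 : 0 <= B := le_trans (nm_ge0 _) (hB 0).
exists (C * B + A * D); first by rewrite addr_ge0 ?mulr_ge0.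
move=> x y e e0 xy.
have -> : f x * g x - f y * g y = (f x - f y) * g x + f y * (g x - g y) by ring.
rewrite (le_trans (nmD _ _))// !nmM.
have -> : (C * B + A * D) * e = (C * e) * B + A * (D * e) by ring.
by rewrite lerD// ler_pM ?nm_ge0 ?hC ?hD.
Qed.

Lemma regularZ c f : regular f -> regular (fun x => c * f x).
Proof. by move=> rf; apply: regularM => //; exact: regular_cst. Qed.

Lemma regularB f g : regular f -> regular g -> regular (fun x => f x - g x).
Proof.
move=> rf rg; have -> : (fun x => f x - g x) = fun x => f x + (-1) * g x.
  by apply/funext => x; rewrite mulN1r.
by apply: regularD => //; exact: regularZ.
Qed.

Lemma regular_sum (I : Type) (r : seq I) (P : pred I) (F : I -> 'rV[R]_d -> R[i]) :
  (forall i, regular (F i)) -> regular (fun x => \sum_(i <- r | P i) F i x).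
Proof.
move=> rF; elim: r => [|i r IH].
  under eq_fun do rewrite big_nil; exact: regular_cst.
under eq_fun do rewrite big_cons.
by case: (P i) => //; exact: regularD.
Qed.

Lemma regular_prod (I : Type) (r : seq I) (P : pred I) (F : I -> 'rV[R]_d -> R[i]) :
  (forall i, regular (F i)) -> regular (fun x => \prod_(i <- r | P i) F i x).
Proof.
move=> rF; elim: r => [|i r IH].
  under eq_fun do rewrite big_nil; exact: regular_cst.
under eq_fun do rewrite big_cons.
by case: (P i) => //; exact: regularM.
Qed.

Lemma regular_shift (a : 'rV[R]_d) f :
  regular f -> regular (fun x => f (x + a)).
Proof.
move=> [pf [A hA] [C C0 hC]]; split.
- by move=> x k; rewrite addrAC pf.
- by exists A.
- exists C => // x y e e0 xy; apply: hC => // j.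
  by rewrite !mxE opprD addrACA subrr addr0; exact: xy.
Qed.

Lemma regular_opp f : regular f -> regular (fun x => f (- x)).
Proof.
move=> [pf [A hA] [C C0 hC]]; split.
- move=> x k; rewrite opprD (_ : - zvec R k = zvec R (- k)) ?pf//.
  by apply/rowP => j; rewrite !mxE mulrNz.
- by exists A.
- exists C => // x y e e0 xy; apply: hC => // j.
  by rewrite !mxE -opprD normrN.
Qed.

Lemma regular_conj f : regular f -> regular (fun x => conjc (f x)).
Proof.
move=> [pf [A hA] [C C0 hC]]; split.
- by move=> x k; rewrite pf.
- by exists A => x; rewrite nm_conj.
- by exists C => // x y e e0 xy; rewrite -rmorphB nm_conj hC.
Qed.

Definition chi (n : 'rV[int]_d) (x : 'rV[R]_d) : R[i] := ee (dot n x).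

Lemma regular_chi n : regular (chi n).
Proof.
split.
- move=> x k; rewrite /chi dotDr eeD; have [m ->] := dot_zvec n k.
  by rewrite ee_int mulr1.
- by exists 1 => x; rewrite nm_ee.
- exists (2 * pi * (norm1 n)%:R); first by rewrite !mulr_ge0 ?pi_ge0.
  move=> x y e e0 xy; rewrite (le_trans (nm_ee_sub _ _))// -dotNr -dotDr.
  rewrite -[leRHS]mulrA ler_wpM2l ?mulr_ge0 ?pi_ge0// dot_le// => j.
  by rewrite !mxE; exact: xy.
Qed.

Lemma chiD m n x : chi (m + n) x = chi m x * chi n x.
Proof. by rewrite /chi dotDl eeD. Qed.

Lemma chi0 x : chi 0 x = 1.
Proof. by rewrite /chi dot0l ee0. Qed.

Lemma chiN n x : chi (- n) x = conjc (chi n x).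
Proof. by rewrite /chi dotNl eeN. Qed.

Lemma chi_shift n x a : chi n (x + a) = chi n x * chi n a.
Proof. by rewrite /chi dotDr eeD. Qed.

Lemma nm_chi n x : nm (chi n x) = 1. Proof. exact: nm_ee. Qed.

(** Real and imaginary parts are averaged separately by the iterated integral,
    so that Fourier coefficients are averages by definition. *)
Definition mean f : R[i] :=
  cube_integral (fun x => complex.Re (f x)) +i*
  cube_integral (fun x => complex.Im (f x)).

Lemma lipschitz_Re f : lipschitz_fun f -> real_lipschitz (fun x => complex.Re (f x)).
Proof.
move=> [C C0 hC]; exists C => // x y e e0 xy.
by rewrite -raddfB; apply: le_trans (Re_le_nm _) (hC _ _ _ e0 xy).
Qed.

Lemma lipschitz_Im f : lipschitz_fun f -> real_lipschitz (fun x => complex.Im (f x)).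
Proof.
move=> [C C0 hC]; exists C => // x y e e0 xy.
by rewrite -raddfB; apply: le_trans (Im_le_nm _) (hC _ _ _ e0 xy).
Qed.

Lemma regular_Re f : regular f -> real_lipschitz (fun x => complex.Re (f x)).
Proof. by case=> _ _ /lipschitz_Re. Qed.

Lemma regular_Im f : regular f -> real_lipschitz (fun x => complex.Im (f x)).
Proof. by case=> _ _ /lipschitz_Im. Qed.

Lemma meanD f g : regular f -> regular g ->
  mean (fun x => f x + g x) = mean f + mean g.
Proof.
move=> rf rg; have [cD _ _ _] := cube_rules R d.
have ReD x : complex.Re (f x + g x) = complex.Re (f x) + complex.Re (g x).
  exact: raddfD.
have ImD x : complex.Im (f x + g x) = complex.Im (f x) + complex.Im (g x).
  exact: raddfD.
rewrite /mean (funext ReD) (funext ImD) !cD; first by [].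
all: by [exact: regular_Re|exact: regular_Im].
Qed.

Lemma meanZ c f : regular f -> mean (fun x => c * f x) = c * mean f.
Proof.
move=> rf; have [cD cZ _ _] := cube_rules R d.
have rR := regular_Re rf; have rI := regular_Im rf.
case: c => a b; rewrite /mean; apply/eqP; rewrite eq_complex /=.
apply/andP; split; apply/eqP.
  rewrite -(cZ a)// -mulNr -(cZ (- b))// -cD; [|exact: real_lipschitzZ..].
  by congr cube_integral; apply/funext => x; case: (f x) => u v /=; ring.
rewrite -(cZ a)// -(cZ b)// -cD; [|exact: real_lipschitzZ..].
by congr cube_integral; apply/funext => x; case: (f x) => u v /=; ring.
Qed.

Lemma mean_cst c : mean (fun _ : 'rV[R]_d => c) = c.
Proof.
by have [_ _ _ cc] := cube_rules R d; rewrite /mean !cc; case: c.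
Qed.

Lemma mean_sum (I : Type) (r : seq I) (P : pred I) (F : I -> 'rV[R]_d -> R[i]) :
  (forall i, regular (F i)) ->
  mean (fun x => \sum_(i <- r | P i) F i x) = \sum_(i <- r | P i) mean (F i).
Proof.
move=> rF; elim: r => [|i r IH].
  by rewrite big_nil; under eq_fun do rewrite big_nil; exact: mean_cst.
rewrite big_cons; under eq_fun do rewrite big_cons.
case: (P i) => //; rewrite meanD ?IH//; exact: regular_sum.
Qed.

Lemma meanB f g : regular f -> regular g ->
  mean (fun x => f x - g x) = mean f - mean g.
Proof.
move=> rf rg; have -> : (fun x => f x - g x) = fun x => f x + (-1) * g x.
  by apply/funext => x; rewrite mulN1r.
by rewrite meanD ?meanZ ?mulN1r//; exact: regularZ.
Qed.

(** Positivity: rotating [mean f] onto the real axis reduces the bound to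
    monotonicity of the real integral. *)
Lemma mean_le f g : regular f -> regular g ->
  (forall x, nm (f x) <= complex.Re (g x)) -> nm (mean f) <= complex.Re (mean g).
Proof.
move=> rf rg fg; have [c [c1 cE]] := exists_phase (mean f).
have rc : regular (fun x => c * f x) by exact: regularZ.
have -> : nm (mean f) = cube_integral (fun x => complex.Re (c * f x)).
  by have := meanZ c rf; rewrite cE => /(congr1 (@complex.Re R)) /= <-.
have [_ _ cm _] := cube_rules R d.
apply: cm => [||x]; [exact: regular_Re..|].
by rewrite (le_trans (ler_norm _))// (le_trans (Re_le_nm _))// nmM c1 mul1r.
Qed.

Lemma mean_bound f (C : R) : regular f -> (forall x, nm (f x) <= C) ->
  nm (mean f) <= C.
Proof.
move=> rf h; have -> : C = complex.Re (mean (fun=> C%:C)) by rewrite mean_cst.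
by apply: mean_le => //; exact: regular_cst.
Qed.

End Algebra.

Lemma slice_coord0 d (t : R) (y : 'rV[R]_d) :
  (row_mx (t%:M : 'rV_1) y : 'rV_d.+1) 0 ord0 = t.
Proof.
by rewrite mxE; case: splitP => // k _; rewrite !ord1 mxE eqxx.
Qed.

Lemma slice_coordS d (t : R) (y : 'rV[R]_d) j :
  (row_mx (t%:M : 'rV_1) y : 'rV_d.+1) 0 (lift ord0 j) = y 0 j.
Proof.
rewrite mxE; case: splitP => [[[|//] ?]//|k /eqP].
by rewrite /= /bump add1n eqSS => /eqP jk; congr (y _ _); apply: val_inj.
Qed.

(** The factor [c] lets the induction on the dimension absorb the phase that
    is contributed by the first coordinate. *)
Lemma cube_Re_chi d (c : R[i]) (n : 'rV[int]_d) :
  cube_integral (fun x => complex.Re (c * chi n x)) =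
  if n == 0 then complex.Re c else 0.
Proof.
elim: d c n => [|d IH] c n.
  by rewrite /= (thinmx0 n) eqxx /chi dot0l ee0 mulr1.
pose n' : 'rV[int]_d := \row_j n 0 (lift ord0 j).
have chiE t y : chi n (row_mx (t%:M : 'rV_1) y) =
    ee ((n 0 ord0)%:~R * t) * chi n' y.
  rewrite /chi -eeD /dot big_ord_recl slice_coord0; congr (ee (_ + _)).
  by apply: eq_bigr => j _; rewrite slice_coordS /n' mxE.
have n0E : (n == 0) = (n 0 ord0 == 0) && (n' == 0).
  apply/eqP/andP => [nE|[/eqP n0 /eqP n'0]].
    rewrite nE mxE eqxx; split=> //; apply/eqP/rowP => j.
    by rewrite /n' nE !mxE.
  apply/rowP => j; rewrite mxE; case: (unliftP ord0 j) => [i ->|-> //].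
  by have /rowP/(_ i) := n'0; rewrite /n' !mxE.
rewrite /=; under eq_Rintegral => t _.
  under eq_fun do rewrite chiE mulrA.
  rewrite IH; over.
rewrite n0E; case: (n' == 0); last first.
  by rewrite andbF Rintegral_cst ?mul0r//; exact: measurable_itv.
rewrite andbT; case: c => a b.
have [->|n00] := eqVneq (n 0 ord0) 0.
  under eq_Rintegral do rewrite mul0r ee0 mulr1.
  by have [_ _ _ /(_ a)] := cube_rules R 1; apply.
rewrite -[RHS](integral_trig a b n00).
by apply: eq_Rintegral => t _; rewrite eeE.
Qed.

Lemma mean_chi d (n : 'rV[int]_d) : mean (chi n) = (n == 0)%:R.
Proof.
have h1 := cube_Re_chi 1 n; have h2 := cube_Re_chi (- 'i) n.
have -> : mean (chi n) = (if n == 0 then 1 else 0) +i* 0.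
  rewrite /mean; congr (_ +i* _).
    by rewrite -[RHS]h1; congr cube_integral; apply/funext => x; rewrite mul1r.
  rewrite (_ : 0 = if n == 0 then complex.Re (- 'i : R[i]) else 0); last first.
    by case: ifP => //=; rewrite oppr0.
  rewrite -h2; congr cube_integral; apply/funext => x.
  by case: (chi n x) => u v /=; ring.
by case: (n == 0).
Qed.

End Regular.

Arguments chi {R d} : simpl never.
Arguments mean {R d} : simpl never.

(** * Density of trigonometric polynomials *)

Section Density.
Variables (R : realType) (d : nat).
Implicit Types (f : 'rV[R]_d -> R[i]) (x y : 'rV[R]_d).

(** Coordinates away from the integers are detected by a trigonometric
    polynomial; this is what turns uniform continuity into an inequality that
    can be averaged exactly. *)
Lemma regular_modulus f (e : R) : regular f -> 0 < e -> exists2 D : R, 0 <= D &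
  forall x y, nm (f x - f y) <=
    e + D * \sum_j nm (ee (x 0 j - y 0 j) - 1) ^+ 2.
Proof.
move=> [pf [A hA] [C C0 hC]] e0.
have A0 : 0 <= A := le_trans (nm_ge0 _) (hA 0).
have C1 : 0 < C + 1 by rewrite ltr_wpDl.
pose a := Num.min (1 / 2) (e / (C + 1)).
have a0 : 0 < a by rewrite lt_min divr_gt0//= divr_gt0.
have a2 : a <= 1 / 2 by rewrite ge_min lexx.
have ae : C * a <= e.
  have : a <= e / (C + 1) by rewrite ge_min lexx orbT.
  rewrite ler_pdivlMr// => h; apply: le_trans h.
  by rewrite mulrC ler_wpM2l ?(ltW a0)// lerDl.
have b0 : 0 < 2 * (1 - cos (2 * pi * a)).
  by rewrite mulr_gt0// one_sub_cos_gt0// a0.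
set b := 2 * _ in b0; exists (2 * A / b).
  by rewrite divr_ge0 ?mulr_ge0 ?(ltW b0).
move=> x y; pose m : 'rV[int]_d := \row_j Num.floor (x 0 j - y 0 j + 1 / 2).
pose r j := x 0 j - y 0 j - (m 0 j)%:~R.
have r2 j : `|r j| <= 1 / 2.
  rewrite /r mxE; have := floor_itv (x 0 j - y 0 j + 1 / 2).
  by rewrite intrD ler_norml => /andP[h1 h2]; apply/andP; split; lra.
have eer j : ee (x 0 j - y 0 j) = ee (r j).
  by rewrite /r [in RHS]eeD -mulrNz ee_int mulr1.
have [small|/existsNP[j /negP]] := pselect (forall j, `|r j| <= a).
  apply: (@le_trans _ _ e); last first.
    rewrite lerDl mulr_ge0 ?divr_ge0 ?mulr_ge0 ?(ltW b0)//.
    by apply: sumr_ge0 => j _; rewrite sqr_ge0.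
  rewrite -(pf x (- m)); apply: le_trans ae; apply: hC; first exact: ltW.
  move=> j; have := small j; rewrite /r !mxE mulrNz.
  by rewrite addrAC.
rewrite -ltNge => /ltW aj.
apply: (@le_trans _ _ (2 * A)).
  by rewrite mulr_natl mulr2n (le_trans (nmD _ _))// nmN lerD.
rewrite -[leLHS]add0r lerD ?(ltW e0)// -{1}(divfK (lt0r_neq0 b0) (2 * A)).
rewrite ler_wpM2l ?divr_ge0 ?mulr_ge0 ?(ltW b0)//.
rewrite (bigD1 j)//=. rewrite eer ler_wpDr//; last first.
  by apply: ee_sub1_ge => //; rewrite aj r2.
by apply: sumr_ge0 => i _; rewrite sqr_ge0.
Qed.

(** A product of trigonometric polynomials in one variable each; the shift [s]
    makes room for negative frequencies. *)
Definition prodpoly (p : 'I_d -> {poly R[i]}) (s : nat) y : R[i] :=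
  \prod_j ((p j).[ee (y 0 j)] * ee (- (s%:R * y 0 j))).

Definition shifted_index q (s : nat) (m : {ffun 'I_d -> 'I_q}) : 'rV[int]_d :=
  \row_j ((m j)%:Z - s%:Z).

Lemma prodpoly_expand p s : exists q, (s < q)%N /\ forall y,
  prodpoly p s y = \sum_(m : {ffun 'I_d -> 'I_q})
    (\prod_j (p j)`_(m j)) * chi (shifted_index s m) y.
Proof.
pose q := (\max_j size (p j) + s.+1)%N.
exists q; split; first by rewrite /q addnS ltnS leq_addl.
move=> y; rewrite /prodpoly.
have exp1 j : (p j).[ee (y 0 j)] * ee (- (s%:R * y 0 j)) =
    \sum_(k < q) (p j)`_k * ee (((k : nat)%:Z - s%:Z)%:~R * y 0 j).
  rewrite (@horner_coef_wide _ q); last first.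
    by rewrite /q (leq_trans (leq_bigmax (F := fun j => size (p j)) j))// leq_addr.
  rewrite mulr_suml; apply: eq_bigr => k _.
  by rewrite -mulrA eeX -eeD rmorphB /= mulrBl.
rewrite (eq_bigr _ (fun j _ => exp1 j)) bigA_distr_bigA /=.
apply: eq_bigr => m _; rewrite big_split /=; congr (_ * _).
by rewrite /chi /dot ee_sum; apply: eq_bigr => j _; rewrite mxE.
Qed.

Lemma chi_sub n x y : chi n (y - x) = chi n y * chi (- n) x.
Proof. by rewrite /chi dotDr dotNr dotNl eeD. Qed.

Lemma regular_refl f y : regular f -> regular (fun x => f (y - x)).
Proof.
move=> rf; have := regular_opp (regular_shift y rf).
by congr regular; apply/funext => x; rewrite addrC.
Qed.

Lemma regular_prodpoly p s : regular (prodpoly p s).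
Proof.
have [q [_ h]] := prodpoly_expand p s; rewrite (funext h).
by apply: regular_sum => m; apply: regularZ; exact: regular_chi.
Qed.

Lemma mean_prodpoly p s y :
  mean (fun x => prodpoly p s (y - x)) = \prod_j (p j)`_s.
Proof.
have [q [sq h]] := prodpoly_expand p s.
have -> : (fun x => prodpoly p s (y - x)) = fun x =>
    \sum_(m : {ffun 'I_d -> 'I_q}) ((\prod_j (p j)`_(m j)) *
      chi (shifted_index s m) y) * chi (- shifted_index s m) x.
  by apply/funext => x; rewrite h; apply: eq_bigr => m _; rewrite chi_sub mulrA.
rewrite mean_sum; last by move=> m; apply: regularZ; exact: regular_chi.
rewrite (bigD1 [ffun=> Ordinal sq])//= [X in _ + X]big1 => [|m mn].
  rewrite addr0 meanZ ?mean_chi; last exact: regular_chi.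
  have -> : shifted_index s [ffun=> Ordinal sq] = 0.
    by apply/rowP => j; rewrite !mxE ffunE subrr.
  rewrite chi0 oppr0 eqxx !mulr1.
  by apply: eq_bigr => j _; rewrite ffunE.
rewrite meanZ ?mean_chi; last exact: regular_chi.
rewrite oppr_eq0 (_ : _ == 0 = false) ?mulr0//.
apply: contraNF mn => /eqP/rowP e; apply/eqP/ffunP => j; rewrite ffunE.
by apply: val_inj; have := e j; rewrite !mxE => /eqP; rewrite subr_eq0 => /eqP[].
Qed.

(** The kernel [prod_j cos^{2N}(pi y_j)], normalised to average one. *)
Definition binpoly (N : nat) : {poly R[i]} :=
  ('C(N.*2, N)%:R^-1)%:P * (1 + 'X) ^+ N.*2.

Definition kernel N := prodpoly (fun=> binpoly N) N.

Definition kernel2 N (j : 'I_d) :=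
  prodpoly (fun i => if i == j then binpoly N * (1 + 'X) ^+ 2
                     else binpoly N * 'X) N.+1.

Lemma coef_1X (n k : nat) : ((1 + 'X) ^+ n : {poly R[i]})`_k = 'C(n, k)%:R.
Proof.
rewrite exprDn coef_sum.
under eq_bigr do rewrite expr1n mul1r coefMn coefXn.
have [kn|nk] := ltnP k n.+1.
  rewrite (bigD1 (Ordinal kn))//= eqxx big1 ?addr0// => i ik.
  rewrite (_ : k == i = false) ?mul0rn//.
  by apply: contraNF ik => /eqP e; apply/eqP/val_inj.
rewrite big1 ?bin_small// => i _.
rewrite (_ : k == i = false) ?mul0rn//; apply/negbTE.
by rewrite gtn_eqF// (leq_ltn_trans _ nk)// -ltnS.
Qed.

Lemma bin_mid_neq0 N : 'C(N.*2, N)%:R != 0 :> R[i].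
Proof. by rewrite pnatr_eq0 -lt0n bin_gt0 -addnn leq_addr. Qed.

Lemma mean_kernel N y : mean (fun x => kernel N (y - x)) = 1.
Proof.
rewrite mean_prodpoly big1// => j _.
by rewrite coefCM coef_1X mulVf ?bin_mid_neq0.
Qed.

Lemma bin_mid_rec N :
  ('C(N.+1.*2, N.+1) * N.+1 = 'C(N.*2, N) * N.*2.+1.*2)%N.
Proof.
have h1 := mul_bin_diag N.*2.+2 N; have h2 := mul_bin_down N.*2.+1 N.
have e1 : (N.*2.+1 - N = N.+1)%N by lia.
rewrite doubleS; move: h1 h2; rewrite e1 /= => h1 h2.
rewrite mulnC -h1 -doubleS -mul2n -mulnA -h2; lia.
Qed.

Lemma mean_kernel2 N j y :
  mean (fun x => kernel2 N j (y - x)) = (4 - 2 / N.+1%:R)%:C.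
Proof.
have c0 := bin_mid_neq0 N.
rewrite mean_prodpoly (bigD1 j)//= eqxx big1 => [|i /negbTE ->]; last first.
  by rewrite coefMX /= coefCM coef_1X mulVf.
rewrite mulr1 -mulrA -exprD addn2 -doubleS coefCM coef_1X.
have := congr1 (fun k : nat => k%:R : R[i]) (bin_mid_rec N).
rewrite !natrM => h.
have N0 : N.+1%:R != 0 :> R[i] by rewrite pnatr_eq0.
apply: (mulIf N0); rewrite -mulrA h mulrA mulVf// mul1r.
rewrite rmorphB rmorphM fmorphV /= !rmorph_nat mulrBl divfK//.
by rewrite -natrM -natrB; [congr (_%:R)|]; lia.
Qed.

(** Up to the shift by [t], the square of [1 + e^{2 pi i t}] is the positive
    number [4 cos^2 (pi t)]. *)
Lemma one_ee_sqr (t : R) : (1 + ee t) ^+ 2 * ee (- t) = (nm (1 + ee t) ^+ 2)%:C.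
Proof.
have e : conjc (1 + ee t) = 1 + ee (- t) by rewrite eeN rmorphD rmorph1.
rewrite -mul_conj e expr2 -mulrA; congr (_ * _).
by rewrite mulrDl mul1r -eeD subrr ee0 addrC.
Qed.

Lemma nm_one_ee (t : R) : nm (1 + ee t) ^+ 2 = 4 - nm (ee t - 1) ^+ 2.
Proof.
rewrite nm_ee_sub1 nm_sqr eeE /= add0r sin2cos2; ring.
Qed.

Lemma kernel_real N y :
  kernel N y =
    (\prod_j ((nm (1 + ee (y 0 j)) ^+ 2) ^+ N / 'C(N.*2, N)%:R))%:C.
Proof.
rewrite /kernel /prodpoly (rmorph_prod (real_complex R)); apply: eq_bigr => j _ /=.
rewrite /binpoly hornerM hornerC horner_exp hornerD hornerX hornerC.
rewrite rmorphM fmorphV rmorph_nat /= rmorphXn /= -one_ee_sqr exprMn eeX.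
by rewrite -exprM mul2n mulrN; ring.
Qed.

Lemma kernel_ge0 N y : 0 <= complex.Re (kernel N y) /\
  kernel N y = (complex.Re (kernel N y))%:C.
Proof.
rewrite kernel_real; split => //=; apply: prodr_ge0 => j _.
by apply: mulr_ge0; [rewrite !exprn_ge0 ?nm_ge0|rewrite invr_ge0 ler0n].
Qed.

Lemma kernel2E N j y :
  kernel2 N j y = kernel N y * (nm (1 + ee (y 0 j)) ^+ 2)%:C.
Proof.
have -> : (nm (1 + ee (y 0 j)) ^+ 2)%:C =
    \prod_i (if i == j then (nm (1 + ee (y 0 j)) ^+ 2)%:C else 1).
  by rewrite -big_mkcond big_pred1_eq.
rewrite -big_split; apply: eq_bigr => i _ /=.
have e1 : ee (- (N.+1%:R * y 0 i)) = ee (- (N%:R * y 0 i)) * ee (- y 0 i).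
  by rewrite -eeD -natr1; congr ee; ring.
rewrite e1; case: eqP => [->|_].
  by rewrite -one_ee_sqr hornerM horner_exp hornerD hornerX hornerC; ring.
have : ee (y 0 i) * ee (- y 0 i) = 1 by rewrite -eeD subrr ee0.
rewrite hornerM hornerX mulr1 => h.
by rewrite -mulrA (mulrCA (ee (y 0 i))) h mulr1.
Qed.

(** Korovkin's argument: the convolution with the kernel is a trigonometric
    polynomial, and averaging the bound of [regular_modulus] against the kernel
    involves only its second moment [mean_kernel2], which is [O(1 / N)]. *)
Lemma trig_dense f (e : R) : regular f -> 0 < e ->
  exists (I : finType) (c : I -> R[i]) (n : I -> 'rV[int]_d),
    forall x, nm (f x - \sum_i c i * chi (n i) x) <= e.
Proof.
move=> rf e0; have e2 : 0 < e / 2 by rewrite divr_gt0.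
have [D D0 hD] := regular_modulus rf e2.
have [N hN] : exists N : nat, D * (d%:R * (2 / N.+1%:R)) <= e / 2.
  pose z := D * (d%:R * 2) / (e / 2).
  have z0 : 0 <= z by rewrite divr_ge0 ?(ltW e2)// !mulr_ge0 ?ler0n.
  exists (Num.trunc z); have /andP[_ zN] := truncn_itv z0.
  have -> : D * (d%:R * (2 / (Num.trunc z).+1%:R)) =
      D * (d%:R * 2) / (Num.trunc z).+1%:R by rewrite !mulrA.
  rewrite ler_pdivrMr// -[leLHS](divfK (lt0r_neq0 e2)) -/z mulrC.
  by rewrite ler_wpM2l ?(ltW e2)// ltW.
have [q [_ hq]] := prodpoly_expand (fun=> binpoly N) N.
pose b (m : {ffun 'I_d -> 'I_q}) := \prod_(j < d) (binpoly N)`_(m j) : R[i].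
exists {ffun 'I_d -> 'I_q},
  (fun m => b m * mean (fun s => f s * chi (- shifted_index N m) s)),
  (fun m => shifted_index N m) => y.
have rK : regular (fun x => kernel N (y - x)).
  by apply: regular_refl; exact: regular_prodpoly.
have -> : \sum_m b m * mean (fun s => f s * chi (- shifted_index N m) s) *
    chi (shifted_index N m) y = mean (fun x => f x * kernel N (y - x)).
  have -> : (fun x => f x * kernel N (y - x)) = fun x => \sum_m
     (b m * chi (shifted_index N m) y) * (f x * chi (- shifted_index N m) x).
    apply/funext => x; rewrite /kernel hq mulr_sumr; apply: eq_bigr => m _.
    by rewrite chi_sub /b; ring.
  rewrite mean_sum => [|m].
    apply: eq_bigr => m _; rewrite meanZ 1?mulrAC//.
    by apply: regularM => //; exact: regular_chi.
  by apply: regularZ; apply: regularM => //; exact: regular_chi.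
rewrite -[f y]mulr1 -[1](mean_kernel N y) -meanZ// -meanB; last 2 first.
- exact: regularZ.
- exact: regularM.
pose G x := (e / 2)%:C * kernel N (y - x) + D%:C *
  \sum_j (4%:R * kernel N (y - x) - kernel2 N j (y - x)).
have rK2 j : regular (fun x => kernel2 N j (y - x)).
  by apply: regular_refl; exact: regular_prodpoly.
have rB j : regular (fun x => 4%:R * kernel N (y - x) - kernel2 N j (y - x)).
  by apply: regularB => //; exact: regularZ.
have rS : regular (fun x => \sum_j (4%:R * kernel N (y - x) - kernel2 N j (y - x))).
  by apply: regular_sum => j.
have rG : regular G by apply: regularD; exact: regularZ.
apply: (@le_trans _ _ (complex.Re (mean G))).
  apply: mean_le => //.
    by apply: regularB; [exact: regularZ|exact: regularM].
  move=> x; rewrite -mulrBl nmM /G.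
  have [K0 KE] := kernel_ge0 N (y - x); set k := complex.Re _ in K0 KE.
  have -> : \sum_j (4%:R * kernel N (y - x) - kernel2 N j (y - x)) =
      (k * \sum_j nm (ee (y 0 j - x 0 j) - 1) ^+ 2)%:C.
    rewrite rmorphM rmorph_sum mulr_sumr /=; apply: eq_bigr => j _.
    rewrite kernel2E KE !mxE nm_one_ee rmorphB /= rmorph_nat; ring.
  rewrite KE nmC ger0_norm//= !mul0r !subr0.
  have := hD y x; nra.
rewrite meanD; [|exact: regularZ..]; rewrite !meanZ// mean_sum//.
under eq_bigr => j _.
  rewrite meanB//; last exact: regularZ.
  rewrite meanZ// mean_kernel mean_kernel2; over.
rewrite mean_kernel sumr_const card_ord !mulr1.
have -> : (4 - (4 - 2 / N.+1%:R)%:C) *+ d = (d%:R * (2 / N.+1%:R))%:C :> R[i].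
  rewrite -mulr_natl [in RHS]rmorphM rmorph_nat; congr (_ * _).
  by rewrite rmorphB /= rmorph_nat; ring.
by rewrite -rmorphM -rmorphD /= [leRHS]splitr lerD2l.
Qed.

End Density.

(** * Bounded functionals on regular functions *)

Section Functionals.
Variables (R : realType) (d : nat).
Implicit Types (f g : 'rV[R]_d -> R[i]) (F G : ('rV[R]_d -> R[i]) -> R[i]).

(** Linear functionals on regular functions that are bounded for the sup norm:
    they play the part of the distributions on the torus with which the
    eigenfunctions are paired. *)
Definition bfun F :=
  [/\ forall f g, regular f -> regular g -> F (fun x => f x + g x) = F f + F g,
      forall c f, regular f -> F (fun x => c * f x) = c * F f
    & exists2 K : R, 0 <= K & forall f e, regular f -> 0 <= e ->
        (forall x, nm (f x) <= e) -> nm (F f) <= K * e].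

Lemma bfun_sum_fun F (I : Type) (r : seq I) (P : pred I)
    (f : I -> 'rV[R]_d -> R[i]) : bfun F -> (forall i, regular (f i)) ->
  F (fun x => \sum_(i <- r | P i) f i x) = \sum_(i <- r | P i) F (f i).
Proof.
move=> [FD FZ _] rf; elim: r => [|i r IH].
  rewrite big_nil; under eq_fun do rewrite big_nil.
  by have := FZ 0 _ (regular_cst d 0); rewrite !mul0r.
rewrite big_cons; under eq_fun do rewrite big_cons.
by case: (P i) => //; rewrite FD ?IH//; exact: regular_sum.
Qed.

Lemma bfunB F f g : bfun F -> regular f -> regular g ->
  F (fun x => f x - g x) = F f - F g.
Proof.
move=> [FD FZ _] rf rg; have -> : (fun x => f x - g x) = fun x => f x + (-1) * g x.
  by apply/funext => x; rewrite mulN1r.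
by rewrite FD ?FZ ?mulN1r//; exact: regularZ.
Qed.

Lemma bfun_mean : bfun (@mean R d).
Proof.
split; [exact: meanD|move=> c f rf; exact: meanZ|].
by exists 1 => // f e rf e0 h; rewrite mul1r; exact: mean_bound.
Qed.

Lemma bfun0 : bfun (fun=> 0).
Proof.
split=> [f g _ _|c f _|]; rewrite ?addr0 ?mulr0//.
by exists 0 => // f e _ _ _; rewrite nm0 mul0r.
Qed.

Lemma bfunD F G : bfun F -> bfun G -> bfun (fun f => F f + G f).
Proof.
move=> [FD FZ [K K0 hK]] [GD GZ [L L0 hL]]; split.
- by move=> f g rf rg; rewrite FD// GD// addrACA.
- by move=> c f rf; rewrite FZ// GZ// mulrDr.
- exists (K + L); first by rewrite addr_ge0.
  move=> f e rf e0 h; rewrite mulrDl (le_trans (nmD _ _))// lerD//.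
    exact: hK.
  exact: hL.
Qed.

Lemma bfunZ c F : bfun F -> bfun (fun f => c * F f).
Proof.
move=> [FD FZ [K K0 hK]]; split.
- by move=> f g rf rg; rewrite FD// mulrDr.
- by move=> a f rf; rewrite FZ// mulrCA.
- exists (nm c * K); first by rewrite mulr_ge0 ?nm_ge0.
  by move=> f e rf e0 h; rewrite nmM -mulrA ler_wpM2l ?nm_ge0 ?hK.
Qed.

Lemma bfun_sum (I : Type) (r : seq I) (P : pred I) (F : I -> _) :
  (forall i, bfun (F i)) -> bfun (fun f => \sum_(i <- r | P i) F i f).
Proof.
move=> bF; elim: r => [|i r IH].
  under eq_fun do rewrite big_nil; exact: bfun0.
under eq_fun do rewrite big_cons.
by case: (P i) => //; exact: bfunD.
Qed.

Lemma bfun_mul F g : bfun F -> regular g -> bfun (fun f => F (fun x => f x * g x)).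
Proof.
move=> [FD FZ [K K0 hK]] rg; split.
- move=> f1 f2 r1 r2; rewrite -FD; [|exact: regularM..].
  by congr F; apply/funext => x; rewrite mulrDl.
- move=> c f rf; rewrite -FZ; last exact: regularM.
  by congr F; apply/funext => x; rewrite mulrA.
- have [_ [A hA] _] := rg; have A0 : 0 <= A := le_trans (nm_ge0 _) (hA 0).
  exists (K * A); first by rewrite mulr_ge0.
  move=> f e rf e0 h; rewrite -mulrA hK ?mulr_ge0//; first exact: regularM.
  by move=> x; rewrite nmM mulrC ler_pM ?nm_ge0.
Qed.

Lemma bfun_shift F a : bfun F -> bfun (fun f => F (fun x => f (x + a))).
Proof.
move=> [FD FZ [K K0 hK]]; split.
- by move=> f1 f2 r1 r2; rewrite -FD//; exact: regular_shift.
- by move=> c f rf; rewrite -FZ//; exact: regular_shift.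
- by exists K => // f e rf e0 h; apply: hK => //; exact: regular_shift.
Qed.

(** By density of trigonometric polynomials. Every identity between functionals
    below is proved by checking it on characters. *)
Lemma bfun_eq F G : bfun F -> bfun G -> (forall n, F (chi n) = G (chi n)) ->
  forall f, regular f -> F f = G f.
Proof.
move=> bF bG FG f rf; apply/eqP; rewrite -subr_eq0 -nm_eq0; apply/negPn/negP => n0.
have [_ FZ [K K0 hK]] := bF; have [_ GZ [L L0 hL]] := bG.
have p0 : 0 < nm (F f - G f) by rewrite lt_def n0 nm_ge0.
set b := nm _ in p0.
have KL : 0 < K + L + 1 by rewrite ltr_wpDl ?addr_ge0.
have e0 : 0 < b / (K + L + 1) by rewrite divr_gt0.
have [I [c [n hc]]] := trig_dense rf e0; set e := b / _ in e0 hc.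
pose P x := \sum_i c i * chi (n i) x.
have rc i : regular (fun x => c i * chi (n i) x).
  by apply: regularZ; exact: regular_chi.
have rP : regular P by exact: regular_sum.
have rfP : regular (fun x => f x - P x) by exact: regularB.
have FGP : F P = G P.
  rewrite /P !bfun_sum_fun//; apply: eq_bigr => i _.
  by rewrite FZ ?GZ ?FG//; exact: regular_chi.
have h1 := hK _ _ rfP (ltW e0) hc; have h2 := hL _ _ rfP (ltW e0) hc.
move: h1 h2; rewrite (bfunB bF rf rP) (bfunB bG rf rP) FGP => h1 h2.
have h3 : b <= (K + L) * e.
  rewrite mulrDl /b -(subrKA (G P)) (le_trans (nmD _ _))// lerD//.
  by rewrite nmB.
have : b = e * (K + L + 1) by rewrite /e divfK// lt0r_neq0.
nra.
Qed.

Lemma mean_shift f a : regular f -> mean (fun x => f (x + a)) = mean f.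
Proof.
apply: (bfun_eq (bfun_shift a bfun_mean) bfun_mean) => n.
have -> : (fun x => chi n (x + a)) = fun x => chi n a * chi n x.
  by apply/funext => x; rewrite chi_shift mulrC.
rewrite meanZ ?mean_chi; last exact: regular_chi.
by case: eqP => [->|_]; rewrite ?chi0 ?mulr1 ?mulr0.
Qed.

End Functionals.

(** * Majorants and unconditional power series *)

Section Domination.
Variable R : realType.
Implicit Types (G : {poly R[i]}) (H : {poly R}).

(** Majorants in the style of Cauchy: for a product of powers of affine factors,
    the value of the majorant is explicit, whereas the coefficients are not. *)
Definition dominated G H := forall p : nat, nm G`_p <= H`_p.

Lemma domM G1 H1 G2 H2 : dominated G1 H1 -> dominated G2 H2 -> dominated (G1 * G2) (H1 * H2).
Proof.
move=> d1 d2 p; rewrite !coefM (le_trans (nm_sum _ _ _))//.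
by apply: ler_sum => i _; rewrite nmM ler_pM ?nm_ge0 ?d1 ?d2.
Qed.

Lemma dom1 : dominated 1 1.
Proof. by move=> p; rewrite !coef1; case: eqP => _; rewrite ?nm1 ?nm0. Qed.

Lemma domX G H n : dominated G H -> dominated (G ^+ n) (H ^+ n).
Proof.
move=> h; elim: n => [|n IH]; first exact: dom1.
by rewrite !exprS; exact: domM.
Qed.

Lemma dom_prod (I : Type) (r : seq I) (G : I -> {poly R[i]}) (H : I -> {poly R}) :
  (forall i, dominated (G i) (H i)) -> dominated (\prod_(i <- r) G i) (\prod_(i <- r) H i).
Proof.
move=> h; elim: r => [|i r IH]; first by rewrite !big_nil; exact: dom1.
by rewrite !big_cons; exact: domM.
Qed.

Lemma dom_affine (a e : R[i]) :
  dominated (a%:P + e *: 'X) ((nm a)%:P + nm e *: 'X).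
Proof.
move=> p; rewrite !coefD !coefC !coefZ !coefX.
by case: p => [|[|p]] /=; rewrite ?mulr1 ?mulr0 ?addr0 ?add0r ?nm0.
Qed.

Lemma dom_sum G H (T : nat -> R[i]) (k r : R) q : dominated G H -> 0 <= k ->
  (size H <= q)%N -> (forall p, nm (T p) <= k * r ^+ p) ->
  nm (\sum_(p < q) G`_p * T p) <= k * H.[r].
Proof.
move=> h k0 sH hT; rewrite (horner_coef_wide _ sH) mulr_sumr.
rewrite (le_trans (nm_sum _ _ _))//; apply: ler_sum => p _.
rewrite nmM mulrCA.
apply: (@le_trans _ _ (H`_p * nm (T p))); first by rewrite ler_wpM2r ?nm_ge0.
by rewrite ler_wpM2l// (le_trans (nm_ge0 _) (h p)).
Qed.

Lemma horner_sum G q (z : R[i]) : (size G <= q)%N ->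
  G.[z] = \sum_(p < q) G`_p * z ^+ p.
Proof. exact: horner_coef_wide. Qed.

Variables (G : {poly R[i]}) (H : {poly R}) (r : R).
Hypotheses (GH : dominated G H) (r0 : 0 < r).

Let q := maxn (size G) (size H).
Let sG : (size G <= q)%N. Proof. exact: leq_maxl. Qed.
Let sH : (size H <= q)%N. Proof. exact: leq_maxr. Qed.

Lemma dom_bound z : nm z <= r -> nm G.[z] <= H.[r].
Proof.
move=> zr; rewrite (horner_sum z sG) -[leRHS]mul1r.
apply: dom_sum sH _ => // p; rewrite nmX mul1r.
by rewrite lerXn2r ?nnegrE ?nm_ge0// ltW.
Qed.

Lemma dom_lip z : nm z <= r -> nm (G.[z] - G.[0]) <= nm z / r * H.[r].
Proof.
move=> zr; rewrite (horner_sum z sG) (horner_sum 0 sG) -sumrB.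
under eq_bigr do rewrite -mulrBr.
apply: (dom_sum (T := fun p => z ^+ p - 0 ^+ p)) sH _ => // [|[|p]].
- by rewrite divr_ge0 ?nm_ge0 ?ltW.
- by rewrite subrr nm0 mulr1 divr_ge0 ?nm_ge0 ?ltW.
rewrite [0 ^+ _]expr0n subr0 nmX !exprS -mulrA mulKf ?lt0r_neq0//.
by rewrite ler_wpM2l ?nm_ge0// lerXn2r ?nnegrE ?nm_ge0// ltW.
Qed.

(** The terms of degree at most one cancel, which is the Cauchy-Riemann equation
    in integrated form; the rest is of second order in [s]. *)
Lemma dom_CR (s : R) : `|s| <= r ->
  nm (G.['i * s%:C] - G.[0] - 'i * (G.[s%:C] - G.[0])) <=
    (2 * (`|s| / r) ^+ 2) * H.[r].
Proof.
move=> sr; rewrite (horner_sum _ sG) (horner_sum 0 sG) (horner_sum s%:C sG).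
rewrite -!sumrB mulr_sumr -sumrB.
have -> : \sum_(p < q) (G`_p * ('i * s%:C) ^+ p - G`_p * 0 ^+ p -
    'i * (G`_p * s%:C ^+ p - G`_p * 0 ^+ p)) = \sum_(p < q) G`_p *
    (('i * s%:C) ^+ p - 0 ^+ p - 'i * (s%:C ^+ p - 0 ^+ p)).
  by apply: eq_bigr => p _; ring.
have k0 : 0 <= 2 * (`|s| / r) ^+ 2 by rewrite mulr_ge0// sqr_ge0.
apply: (dom_sum (T := fun p => ('i * s%:C) ^+ p - 0 ^+ p - 'i *
  (s%:C ^+ p - 0 ^+ p))) sH _ => // [[|[|p]]].
- by rewrite !expr0 !subrr mulr0 subr0 nm0 mulr1.
- by rewrite !expr1 !subr0 subrr nm0 mulr_ge0// ltW.
rewrite ![0 ^+ _]expr0n !subr0 (le_trans (nmD _ _))// nmN nmX (nmM _ (_ ^+ _)) nmX nmM nmi nmC.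
rewrite !mul1r [leLHS](_ : _ = 2 * `|s| ^+ p.+2); last by ring.
rewrite -mulrA ler_wpM2l//.
have r_neq0 : r != 0 by rewrite lt0r_neq0.
rewrite [leRHS](_ : _ = `|s| ^+ 2 * r ^+ p); last first.
  by rewrite -[p.+2]add2n exprD; field.
rewrite -[p.+2]add2n exprD ler_wpM2l ?sqr_ge0//.
by rewrite lerXn2r ?nnegrE// ltW.
Qed.

End Domination.

Section PowerSeries.
Variable R : realType.

Section Sums.
Variable I : choiceType.
Implicit Types (a b : I -> R[i]) (s t : R[i]).

Lemma has_sumD a b s t : has_sum a s -> has_sum b t ->
  has_sum (fun i => a i + b i) (s + t).
Proof.
move=> /has_sum_nm ha /has_sum_nm hb; apply/has_sum_nm => e e0.
have e2 : 0 < e / 2 by rewrite divr_gt0.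
have [J1 h1] := ha _ e2; have [J2 h2] := hb _ e2.
exists (J1 `|` J2)%fset => J; rewrite fsubUset => /andP[/h1 k1 /h2 k2].
rewrite big_split opprD addrACA (le_trans (nmD _ _))// [leRHS]splitr.
exact: lerD.
Qed.

Lemma has_sumZ c a s : has_sum a s -> has_sum (fun i => c * a i) (c * s).
Proof.
move=> /has_sum_nm ha; apply/has_sum_nm => e e0.
have c0 : 0 < nm c + 1 by rewrite ltr_wpDl ?nm_ge0.
have [J1 h1] := ha (e / (nm c + 1)) (divr_gt0 e0 c0).
exists J1 => J /h1 h; rewrite -mulr_sumr -mulrBr nmM.
have := ler_pM (nm_ge0 c) (nm_ge0 _) (lexx (nm c)) h.
move=> /le_trans; apply; rewrite mulrCA ler_piMr ?ltW//.
by rewrite -[X in _ / X]/(nm c + 1) ltr_pdivrMr// mul1r ltrDl.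
Qed.

Lemma has_sumB a b s t : has_sum a s -> has_sum b t ->
  has_sum (fun i => a i - b i) (s - t).
Proof.
move=> ha hb; have := has_sumD ha (@has_sumZ (-1) _ _ hb); rewrite mulN1r.
by congr (has_sum _ _); apply/funext => i; rewrite mulN1r.
Qed.

Lemma has_sum_le a s (B : R) : has_sum a s ->
  (forall J : {fset I}, nm (\sum_(i <- J) a i) <= B) -> nm s <= B.
Proof.
move=> /has_sum_nm ha h; apply/ler_addgt0Pr => e e0.
have [J hJ] := ha e e0.
rewrite -(subrK (\sum_(i <- J) a i) s) addrC (le_trans (nmD _ _))//.
by rewrite lerD ?h// nmB hJ.
Qed.

(** Unconditional convergence bounds the sum over any finite set that avoids a
    fixed one; separating the signs of real and imaginary parts turns this into
    a bound on the sum of the moduli. *)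
Lemma has_sum_abs a s : has_sum a s -> exists2 K : R, 0 <= K &
  forall J : {fset I}, \sum_(i <- J) nm (a i) <= K.
Proof.
move=> /has_sum_nm /(_ 1 ltr01)[J0 hJ0].
have small (J : {fset I}) : [disjoint J & J0]%fset ->
    nm (\sum_(i <- J) a i) <= 2.
  move=> dJ; have h1 := hJ0 (J0 `|` J)%fset (fsubsetUl _ _).
  have h0 := hJ0 J0 (fsubset_refl _).
  have -> : \sum_(i <- J) a i =
      (\sum_(i <- (J0 `|` J)%fset) a i - s) - (\sum_(i <- J0) a i - s).
    rewrite sum_fsetU; last by rewrite fdisjoint_sym.
    by ring.
  rewrite (le_trans (nmD _ _))// nmN; lra.
(* the sum of |g| over J is split according to the sign of g *)
have part (g : R[i] -> R) (gD : forall J : {fset I},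
      g (\sum_(i <- J) a i) = \sum_(i <- J) g (a i))
    (gle : forall z, `|g z| <= nm z) (J : {fset I}) :
    [disjoint J & J0]%fset -> \sum_(i <- J) `|g (a i)| <= 4.
  move=> dJ; pose Jp := [fset i in J | 0 <= g (a i)]%fset.
  pose Jn := [fset i in J | ~~ (0 <= g (a i))]%fset.
  have bnd (K : {fset I}) : (K `<=` J)%fset -> `|\sum_(i <- K) g (a i)| <= 2.
    move=> KJ; rewrite -gD (le_trans (gle _))// small//.
    exact: fdisjointWl KJ dJ.
  have bp : \sum_(i <- Jp) `|g (a i)| <= 2.
    rewrite (eq_big_seq (fun i => g (a i))); last first.
      by move=> i; rewrite !inE => /andP[_ /ger0_norm].
    by rewrite (le_trans (ler_norm _))// bnd// fset_sub.
  have bn : \sum_(i <- Jn) `|g (a i)| <= 2.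
    rewrite (eq_big_seq (fun i => - g (a i))); last first.
      by move=> i; rewrite !inE -ltNge => /andP[_ /ltr0_norm].
    by rewrite sumrN (le_trans (ler_norm _))// normrN bnd// fset_sub.
  have -> : \sum_(i <- J) `|g (a i)| =
      \sum_(i <- Jp) `|g (a i)| + \sum_(i <- Jn) `|g (a i)|.
    exact: (big_fsetID _ (fun i => 0 <= g (a i))).
  lra.
have bR := part (@complex.Re R) (fun J => raddf_sum _ _ _ _) (@Re_le_nm R).
have bI := part (@complex.Im R) (fun J => raddf_sum _ _ _ _) (@Im_le_nm R).
exists (\sum_(i <- J0) nm (a i) + 8).
  by rewrite addr_ge0// sumr_ge0// => i _; exact: nm_ge0.
move=> J; rewrite (sum_fsetID J J0) lerD//.
  rewrite [leRHS](sum_fsetID J0 J) fsetIC lerDl.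
  by apply: sumr_ge0 => i _; exact: nm_ge0.
have dis : [disjoint J `\` J0 & J0]%fset.
  by apply/fdisjointP => i; rewrite !inE => /andP[].
have hR := bR _ dis; have hI := bI _ dis.
apply: (@le_trans _ _ (\sum_(i <- (J `\` J0)%fset)
   (`|complex.Re (a i)| + `|complex.Im (a i)|))).
  by apply: ler_sum => i _; exact: nm_le_ReIm.
by rewrite big_split /=; lra.
Qed.

End Sums.

End PowerSeries.

(** * Local bounds for analytic functions *)

Section LocalEstimates.
Variables (R : realType) (d : nat).
Implicit Types (S : set 'rV[R[i]]_d) (f : 'rV[R[i]]_d -> R[i]) (x y z e : 'rV[R[i]]_d).

(** The set [S] is the whole space for complex analytic functions and the set of
    real points for real analytic ones. *)
Definition has_series S f x := exists (c : {ffun 'I_d -> nat} -> R[i]) (r : R),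
  0 < r /\ forall y, S y -> (forall j, nm (y 0 j - x 0 j) < r) ->
    has_sum (fun m => c m * \prod_(j < d) (y 0 j - x 0 j) ^+ m j) (f y).

(** Size, Lipschitz and Cauchy-Riemann bounds at [z], with a single constant so
    that compactness applies to all three together. *)
Definition local_bounds S f (C : R) z :=
  [/\ S z -> nm (f z) <= C,
      forall e u, (forall j, nm (e 0 j) <= 1) -> C * nm u <= 1 ->
        S z -> S (z + u *: e) -> nm (f (z + u *: e) - f z) <= C * nm u
    & forall e (s : R), (forall j, nm (e 0 j) <= 1) -> C * `|s| <= 1 ->
        S z -> S (z + ('i * s%:C) *: e) -> S (z + s%:C *: e) ->
        nm (f (z + ('i * s%:C) *: e) - f z - 'i * (f (z + s%:C *: e) - f z))
          <= C * s ^+ 2].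

Lemma local_bounds_mono S f C C' z : C <= C' -> local_bounds S f C z -> local_bounds S f C' z.
Proof.
move=> CC' [h1 h2 h3]; split.
- by move=> Sz; rewrite (le_trans (h1 Sz)).
- move=> e u e1 u1 Sz Su; apply: le_trans (h2 e u e1 _ Sz Su) _.
    by rewrite (le_trans _ u1)// ler_wpM2r ?nm_ge0.
  by rewrite ler_wpM2r ?nm_ge0.
- move=> e s e1 s1 Sz S1 S2; apply: le_trans (h3 e s e1 _ Sz S1 S2) _.
    by rewrite (le_trans _ s1)// ler_wpM2r.
  by rewrite ler_wpM2r ?sqr_ge0.
Qed.

Lemma has_series_local_bounds S f x : has_series S f x ->
  (forall s : R, 0 <= s -> S (x + const_mx s%:C)) ->
  exists2 a : R, 0 < a & exists C : R, forall z,
    (forall j, nm (z 0 j - x 0 j) <= a) -> local_bounds S f C z.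
Proof.
move=> [c [r [r0 hs]]] hS; pose a := r / 3; have a0 : 0 < a by rewrite divr_gt0.
have a2r : a + a < r by rewrite /a; lra.
pose w (m : {ffun 'I_d -> nat}) := \prod_(j < d) (a + a) ^+ m j.
have w0 m : 0 <= w m by apply: prodr_ge0 => j _; rewrite exprn_ge0// addr_ge0// ltW.
(* absolute convergence at the corner of the polydisc of radius 2a *)
have [K K0 hK] : exists2 K : R, 0 <= K &
    forall J : {fset {ffun 'I_d -> nat}}, \sum_(m <- J) nm (c m) * w m <= K.
  have Sa : S (x + const_mx (a + a)%:C).
    by apply: hS; rewrite addr_ge0// ltW.
  have Sr (j : 'I_d) : nm ((x + const_mx (a + a)%:C) 0 j - x 0 j) < r.
    by rewrite !mxE addrAC subrr add0r nmC ger0_norm// addr_ge0// ltW.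
  have [K K0 hK] := has_sum_abs (hs _ Sa Sr).
  exists K => // J; apply: le_trans (hK J); apply: ler_sum => m _.
  rewrite nmM nm_prod ler_wpM2l ?nm_ge0//; apply: ler_prod => j _.
  have aa : 0 <= a + a by rewrite addr_ge0// ltW.
  by rewrite !mxE addrAC subrr add0r nmX nmC (ger0_norm aa) lexx exprn_ge0.
have bound (T : {ffun 'I_d -> nat} -> R[i]) (k : R) : 0 <= k ->
    (forall m, nm (T m) <= k * w m) -> forall J : {fset {ffun 'I_d -> nat}},
    nm (\sum_(m <- J) c m * T m) <= k * K.
  move=> k0 hT J; rewrite (le_trans (nm_sum _ _ _))//.
  apply: (@le_trans _ _ (k * \sum_(m <- J) nm (c m) * w m)); last first.
    by rewrite ler_wpM2l.
  rewrite mulr_sumr; apply: ler_sum => m _.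
  by rewrite nmM mulrCA ler_wpM2l ?nm_ge0.
pose C := K + K / a + 2 * K / a ^+ 2 + a^-1.
have t1 : 0 <= K / a by rewrite divr_ge0// ltW.
have t2 : 0 <= 2 * K / a ^+ 2 by apply: divr_ge0; [exact: mulr_ge0|exact: sqr_ge0].
have t3 : 0 <= a^-1 by rewrite invr_ge0 ltW.
exists a => //; exists C => z zx.
have ra (t : R) : C * t <= 1 -> 0 <= t -> t <= a.
  move=> Ct t0; have : a^-1 * t <= 1.
    by apply: le_trans Ct; rewrite ler_wpM2r// /C; lra.
  by rewrite mulrC ler_pdivrMr// mul1r.
pose G e (m : {ffun 'I_d -> nat}) : {poly R[i]} :=
  \prod_(j < d) ((z 0 j - x 0 j)%:P + e 0 j *: 'X) ^+ m j.
pose H e (m : {ffun 'I_d -> nat}) : {poly R} :=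
  \prod_(j < d) ((nm (z 0 j - x 0 j))%:P + nm (e 0 j) *: 'X) ^+ m j.
have GH e m : dominated (G e m) (H e m).
  by apply: dom_prod => j; apply: domX; exact: dom_affine.
have Hw e m : (forall j, nm (e 0 j) <= 1) -> (H e m).[a] <= w m.
  move=> e1; rewrite /H horner_prod; apply: ler_prod => j _.
  rewrite horner_exp hornerD hornerC hornerZ hornerX.
  have u0 : 0 <= nm (z 0 j - x 0 j) + nm (e 0 j) * a.
    by rewrite addr_ge0 ?mulr_ge0 ?nm_ge0// ltW.
  have aa : 0 <= a + a by rewrite addr_ge0// ltW.
  rewrite exprn_ge0//= lerXn2r ?nnegrE//.
  by rewrite lerD// ler_piMl// ltW.
have Gsum e u : (forall j, nm (e 0 j) <= 1) -> nm u <= a -> S (z + u *: e) ->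
    has_sum (fun m => c m * (G e m).[u]) (f (z + u *: e)).
  move=> e1 ua Su; have /(hs _ Su) : forall j, nm ((z + u *: e) 0 j - x 0 j) < r.
    move=> j; apply: le_lt_trans a2r; rewrite !mxE addrAC.
    rewrite (le_trans (nmD _ _))// lerD// nmM.
    by rewrite (le_trans _ ua)// ler_piMr ?nm_ge0.
  congr has_sum; apply/funext => m; congr (_ * _); rewrite horner_prod.
  apply: eq_bigr => j _; rewrite horner_exp hornerD hornerC hornerZ hornerX !mxE.
  by congr (_ ^+ _); ring.
have Gsum0 e : (forall j, nm (e 0 j) <= 1) -> S z ->
    has_sum (fun m => c m * (G e m).[0]) (f z).
  move=> e1 Sz; rewrite -[z in f z](addr0 z) -(scale0r e); apply: Gsum => //.
    by rewrite nm0 ltW.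
  by rewrite scale0r addr0.
split.
- move=> Sz; have e1 : forall j : 'I_d, nm ((0 : 'rV[R[i]]_d) 0 j) <= 1.
    by move=> j; rewrite mxE nm0.
  apply: (@le_trans _ _ K); last by rewrite /C; lra.
  apply: (has_sum_le (Gsum0 _ e1 Sz)) => J; rewrite -[K]mul1r.
  apply: bound => // m; rewrite mul1r (le_trans _ (Hw _ m e1))//.
  by apply: (dom_bound (GH _ _) a0); rewrite nm0 ltW.
- move=> e u e1 Cu Sz Su; have ua := ra _ Cu (nm_ge0 u).
  apply: (@le_trans _ _ (nm u / a * K)); last first.
    by rewrite mulrAC -mulrA mulrC ler_wpM2r ?nm_ge0// /C; lra.
  apply: (has_sum_le (has_sumB (Gsum _ _ e1 ua Su) (Gsum0 _ e1 Sz))) => J.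
  under eq_bigr do rewrite -mulrBr.
  have ua0 : 0 <= nm u / a by rewrite divr_ge0 ?nm_ge0// ltW.
  apply: (bound (fun m => (G e m).[u] - (G e m).[0])) => // m.
  apply: le_trans (dom_lip (GH _ _) a0 ua) _.
  by rewrite ler_wpM2l// Hw.
- move=> e s e1 Cs Sz S1 S2; have sa := ra _ Cs (normr_ge0 s).
  have s1 : nm s%:C <= a by rewrite nmC.
  have s2 : nm ('i * s%:C) <= a by rewrite nmM nmi mul1r.
  apply: (@le_trans _ _ (2 * (`|s| / a) ^+ 2 * K)); last first.
    rewrite expr_div_n real_normK ?num_real//.
    rewrite [leLHS](_ : _ = 2 * K / a ^+ 2 * s ^+ 2); last by ring.
    by rewrite ler_wpM2r ?sqr_ge0// /C; lra.
  have h0 := Gsum0 _ e1 Sz.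
  apply: (has_sum_le (has_sumB (has_sumB (Gsum _ _ e1 s2 S1) h0)
    (@has_sumZ _ _ 'i _ _ (has_sumB (Gsum _ _ e1 s1 S2) h0)))) => J.
  have -> : \sum_(m <- J) (c m * (G e m).['i * s%:C] - c m * (G e m).[0] -
      'i * (c m * (G e m).[s%:C] - c m * (G e m).[0])) =
    \sum_(m <- J) c m * ((G e m).['i * s%:C] - (G e m).[0] -
      'i * ((G e m).[s%:C] - (G e m).[0])).
    by apply: eq_bigr => m _; ring.
  have k0 : 0 <= 2 * (`|s| / a) ^+ 2 by rewrite mulr_ge0// sqr_ge0.
  apply: (bound (fun m => (G e m).['i * s%:C] - (G e m).[0] -
      'i * ((G e m).[s%:C] - (G e m).[0]))) => // m.
  apply: le_trans (dom_CR (GH _ _) a0 sa) _.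
  by rewrite ler_wpM2l// Hw.
Qed.

End LocalEstimates.

Section Compactness.
Variable R : realType.

(** Compactness of the cube for a property that carries a monotone constant. *)
Lemma cube_uniform n (P : R -> 'rV[R]_n -> Prop) :
  (forall p C C', C <= C' -> P C p -> P C' p) ->
  (forall p : 'rV[R]_n, (forall j, 0 <= p 0 j <= 1) -> exists2 a : R, 0 < a &
     exists C : R, forall q : 'rV[R]_n, (forall j, `|q 0 j - p 0 j| < a) -> P C q) ->
  exists C : R, forall p : 'rV[R]_n, (forall j, 0 <= p 0 j <= 1) -> P C p.
Proof.
move=> Pm Pl; pose K := [set p : 'rV[R]_n | forall j, `[0, 1]%classic (p 0 j)].
have cK : compact K.
  exact: (@rV_compact R n (fun=> `[0, 1]%classic) (fun=> @segment_compact R 0 1)).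
have /compact_near_coveringP cov := cK.
have [|M [Mr hM]] := cov R (+oo%R) P _.
  move=> p Kp; have [|a a0 [C hC]] := Pl p.
    by move=> j; have := Kp j; rewrite /= in_itv.
  exists ([set q : 'rV[R]_n | forall j, `|q 0 j - p 0 j| < a], [set C' | C <= C']) => /=.
    split; last by exists C; split => [|y /ltW//]; exact: num_real.
    have := @nbhsx_ballx _ _ p a a0; apply: filterS => q pq j.
    have [_ /(_ 0 j)] := (pq : 0 < a /\ forall i j, ball (p i j) a (q i j)).
    by rewrite /ball /= distrC.
  by case=> q C' /= [hq CC']; apply: Pm CC' _; exact: hC.
exists (M + 1) => p p01; apply: hM; first by rewrite ltrDl.
by move=> j; rewrite /= in_itv /= p01.
Qed.

End Compactness.

(** * From local bounds to regular functions *)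

Section Uniform.
Variables (R : realType) (d : nat).
Implicit Types (S : set 'rV[R[i]]_d) (f : 'rV[R[i]]_d -> R[i]) (x y : 'rV[R]_d).

Definition emb x : 'rV[R[i]]_d := map_mx (real_complex R) x.

Lemma embD x y : emb (x + y) = emb x + emb y.
Proof. exact: map_mxD. Qed.

Lemma embZ (c : R) x : emb (c *: x) = c%:C *: emb x.
Proof. exact: map_mxZ. Qed.

Lemma emb_zvec (k : 'rV[int]_d) : emb (zvec R k) = zvec R[i] k.
Proof. by apply/rowP => j; rewrite !mxE rmorph_int. Qed.

Lemma local_bounds_uniform S f n (z : 'rV[R]_n -> 'rV[R[i]]_d) (L : R) : 0 < L ->
  (forall (p q : 'rV[R]_n) (a : R), (forall j, `|q 0 j - p 0 j| < a) ->
     forall j, nm (z q 0 j - z p 0 j) <= L * a) ->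
  (forall p : 'rV[R]_n, (forall j, 0 <= p 0 j <= 1) -> has_series S f (z p) /\
     forall s : R, 0 <= s -> S (z p + const_mx s%:C)) ->
  exists C : R, forall p : 'rV[R]_n, (forall j, 0 <= p 0 j <= 1) -> local_bounds S f C (z p).
Proof.
move=> L0 zL ps; apply: (@cube_uniform R n (fun C p => local_bounds S f C (z p))).
  by move=> p C C'; exact: local_bounds_mono.
move=> p p01; have [pp pS] := ps p p01; have [a a0 [C hC]] := has_series_local_bounds pp pS.
exists (a / L); first by rewrite divr_gt0.
exists C => q qp; apply: hC => j; apply: le_trans (zL _ _ _ qp j) _.
by rewrite mulrC divfK ?lt0r_neq0.
Qed.

Lemma cube_repr x : exists k : 'rV[int]_d, forall j, 0 <= (x + zvec R k) 0 j <= 1.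
Proof.
exists (\row_j - Num.floor (x 0 j)) => j; rewrite !mxE mulrNz subr_ge0.
have /andP[h1 h2] := floor_itv (x 0 j); rewrite h1 /=.
by move: h2; rewrite intrD lerBlDr addrC => /ltW.
Qed.

Lemma regular_of_local_bounds S f (z0 : 'rV[R[i]]_d) (C : R) (g : 'rV[R]_d -> R[i]) :
  (forall x, g x = f (emb x + z0)) -> (forall x, S (emb x + z0)) ->
  (forall x k, g (x + zvec R k) = g x) ->
  (forall x, (forall j, 0 <= x 0 j <= 1) -> local_bounds S f C (emb x + z0)) -> regular g.
Proof.
move=> gf gS gp hC.
have gb x : nm (g x) <= C.
  have [k xk] := cube_repr x; rewrite -(gp x k) gf.
  by have [h _ _] := hC _ xk; exact: h.
have C0 : 0 <= C := le_trans (nm_ge0 _) (gb 0).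
split => //; first by exists C.
exists (C + 2 * C * C); first by rewrite addr_ge0 ?mulr_ge0.
move=> y x e e0 yx; have [Ce|Ce] := leP (C * e) 1; last first.
  apply: (@le_trans _ _ (C + C)).
    by rewrite (le_trans (nmD _ _))// nmN lerD.
  nra.
have [k xk] := cube_repr x; rewrite -(gp x k) -(gp y k).
have [_ h _] := hC _ xk; move: e0; rewrite le_eqVlt => /predU1P[e0|e0].
  have -> : y = x.
    by apply/rowP => j; apply/eqP; rewrite -subr_eq0 -normr_le0 e0; exact: yx.
  by rewrite subrr nm0 -e0 mulr0.
pose v : 'rV[R]_d := e^-1 *: (y - x).
have yE : emb (y + zvec R k) + z0 = emb (x + zvec R k) + z0 + e%:C *: emb v.
  rewrite -embZ /v scalerA divff ?lt0r_neq0// scale1r addrAC -embD.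
  by congr (emb _ + _); apply/rowP => j; rewrite !mxE; ring.
have v1 j : nm (emb v 0 j) <= 1.
  have ei : 0 <= e^-1 by rewrite invr_ge0 ltW.
  rewrite !mxE nmC normrM (ger0_norm ei) mulrC.
  by rewrite ler_pdivrMr// mul1r; exact: yx.
have := h (emb v) e%:C v1; rewrite nmC gtr0_norm// -yE -!gf.
move=> /(_ Ce (gS _) (gS _)) /le_trans; apply.
by rewrite mulrDl lerDl !mulr_ge0// ltW.
Qed.

(** The quantity that must be bounded below is periodic, so compactness of the
    cube keeps it away from zero. *)
Lemma regular_inv (f : 'rV[R]_d -> R[i]) : regular f -> (forall x, f x != 0) ->
  regular (fun x => (f x)^-1).
Proof.
move=> [fp [A hA] [L L0 hL]] f0.
have [C hC] : exists C : R, forall p : 'rV[R]_d, (forall j, 0 <= p 0 j <= 1) ->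
    1 <= C * nm (f p).
  apply: (@cube_uniform R d (fun C p => 1 <= C * nm (f p))).
    by move=> p C C' CC' /le_trans; apply; rewrite ler_wpM2r ?nm_ge0.
  move=> p _; have n0 : 0 < nm (f p) by rewrite lt_def nm_eq0 f0 nm_ge0.
  set m := nm (f p) in n0; have L1 : 0 < L + 1 by rewrite ltr_wpDl.
  exists (m / 2 / (L + 1)); first by rewrite !divr_gt0.
  exists (2 / m) => q qp.
  have h : nm (f p - f q) <= L * (m / 2 / (L + 1)).
    apply: hL; first by rewrite !divr_ge0// ltW.
    by move=> j; rewrite distrC ltW.
  have h2 : L * (m / 2 / (L + 1)) <= m / 2.
    rewrite mulrA ler_pdivrMr// mulrC ler_wpM2l ?divr_ge0 ?(ltW n0)//.
    by rewrite lerDl.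
  have h3 : m <= nm (f p - f q) + nm (f q).
    by rewrite /m -{1}(subrK (f q) (f p)) nmD.
  have h4 : m / 2 <= nm (f q) by lra.
  by rewrite mulrAC ler_pdivlMr// mul1r; lra.
have C1 x : nm (f x)^-1 <= C.
  have [k xk] := cube_repr x; rewrite -(fp x k).
  have n0 : 0 < nm (f (x + zvec R k)) by rewrite lt_def nm_eq0 f0 nm_ge0.
  by rewrite nmV -div1r ler_pdivrMr// hC.
have C0 : 0 <= C := le_trans (nm_ge0 _) (C1 0).
split.
- by move=> x k; rewrite fp.
- by exists C.
- exists (C * C * L); first by rewrite !mulr_ge0.
  move=> x y e e0 xy.
  have -> : (f x)^-1 - (f y)^-1 = (f x)^-1 * (f y)^-1 * (f y - f x).
    by field; rewrite !f0.
  by rewrite !nmM nmB -[leRHS]mulrA !ler_pM ?mulr_ge0 ?nm_ge0 ?hL.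
Qed.

Section Matrices.
Variable N : nat.
Implicit Types B : 'rV[R]_d -> 'M[R[i]]_N.

Lemma regular_det n (B : 'rV[R]_d -> 'M[R[i]]_n) :
  (forall i j, regular (fun x => B x i j)) -> regular (fun x => \det (B x)).
Proof.
move=> rB; rewrite /determinant; apply: regular_sum => s.
by apply: regularZ; apply: regular_prod.
Qed.

Lemma regular_invmx B : (forall i j, regular (fun x => B x i j)) ->
  (forall x, B x \in unitmx) ->
  forall i j, regular (fun x => invmx (B x) i j).
Proof.
move=> rB uB i j.
have -> : (fun x => invmx (B x) i j) =
    fun x => (\det (B x))^-1 * ((-1) ^+ (j + i) * \det (row' j (col' i (B x)))).
  by apply/funext => x; rewrite /invmx uB !mxE.
apply: regularM.
  apply: regular_inv; first exact: regular_det.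
  by move=> x; have := uB x; rewrite unitmxE unitfE.
apply: regularZ; apply: regular_det => k l.
by under eq_fun do rewrite !mxE.
Qed.

End Matrices.

End Uniform.

(** * Analytic functions on a strip and decay of Fourier coefficients *)

Section Strip.
Variables (R : realType) (d : nat).
Implicit Types (f : 'rV[R[i]]_d -> R[i]) (x y e : 'rV[R]_d) (t : R).

Lemma has_series_complex f z : analytic_at f z -> has_series setT f z.
Proof.
move=> [c [r [r0 h]]]; exists c, (complex.Re r).
have rE : r = (complex.Re r)%:C.
  by case: r r0 {h} => a b /=; rewrite ltcE /= => /andP[/eqP ->].
split; first by move: r0; rewrite {1}rE ltcR.
by move=> y _ yz; apply: h => j; rewrite normr_nm rE ltcR.
Qed.

Lemma has_series_real (w : 'rV[R]_d -> R) x : analytic_at w x ->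
  has_series [set z | exists y, z = emb y]
    (fun z => (w (map_mx (@complex.Re R) z))%:C) (emb x).
Proof.
move=> [c [r [r0 h]]]; exists (fun m => (c m)%:C), r; split=> // z [y ->] yx.
have Re_emb : map_mx (@complex.Re R) (emb y) = y by apply/rowP => j; rewrite !mxE.
have {}yx j : `|y 0 j - x 0 j| < r.
  by have := yx j; rewrite !mxE -rmorphB nmC.
rewrite Re_emb; have /has_sum_norm hs := h y yx.
apply/has_sum_nm => e e0; have [J0 hJ] := hs e e0; exists J0 => J /hJ.
rewrite distrC -nmC rmorphB rmorph_sum /=; congr (nm (_ - _) <= _).
apply: eq_bigr => m _; rewrite rmorphM rmorph_prod; congr (_ * _).
by apply: eq_bigr => j _; rewrite rmorphXn /= !mxE rmorphB.
Qed.

(** Analyticity of [w] enters only through the local Lipschitz bound, which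
    periodicity and compactness of the unit cube make uniform. *)
Lemma regular_real_analytic (w : 'rV[R]_d -> R) : real_analytic_torus w ->
  regular (fun x => (w x)%:C).
Proof.
move=> [wp wa]; pose S := [set z : 'rV[R[i]]_d | exists y, z = emb y].
pose f (z : 'rV[R[i]]_d) := (w (map_mx (@complex.Re R) z))%:C.
have [||C hC] := @local_bounds_uniform R d S f d (@emb R d) 1 ltr01.
- by move=> p q a qp j; rewrite !mxE -rmorphB nmC mul1r ltW.
- move=> p _; split; first exact: has_series_real.
  move=> s _; exists (p + const_mx s); rewrite embD; congr (_ + _).
  by apply/rowP => j; rewrite !mxE.
apply: (@regular_of_local_bounds R d S f 0 C).
- move=> x; rewrite addr0 /f; congr (w _)%:C.
  by apply/rowP => j; rewrite !mxE.
- by move=> x; exists x; rewrite addr0.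
- by move=> x k; rewrite wp.
- by move=> x x01; rewrite addr0; exact: hC.
Qed.

Variables (h : R) (f : 'rV[R[i]]_d -> R[i]).
Hypothesis h0 : 0 < h.
Hypothesis f_periodic : forall z, strip h z -> forall k, f (z + zvec R[i] k) = f z.
Hypothesis f_analytic : forall z, strip h z -> analytic_at f z.

(** The point over [x] at height [t] in the direction [e] of the strip. *)
Definition tilt (e : 'rV[R]_d) (t : R) x : 'rV[R[i]]_d :=
  emb x + ('i * t%:C) *: emb e.

Lemma tilt_coord e t x j :
  tilt e t x 0 j = (x 0 j)%:C + 'i * (t * e 0 j)%:C.
Proof. by rewrite !mxE -mulrA -rmorphM. Qed.

Lemma tilt_Im e t x j : complex.Im (tilt e t x 0 j) = t * e 0 j.
Proof. by rewrite tilt_coord /=; ring. Qed.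

Lemma tilt_strip e t x : (forall j, `|e 0 j| <= 1) -> `|t| < h ->
  strip h (tilt e t x).
Proof.
move=> e1 th j; rewrite tilt_Im normrM.
by apply: le_lt_trans th; rewrite ler_piMr.
Qed.

Lemma tilt_zvec e t x k : tilt e t (x + zvec R k) = tilt e t x + zvec R[i] k.
Proof. by rewrite /tilt embD emb_zvec addrAC. Qed.

Lemma tilt_up e t (s : R) x :
  tilt e t x + ('i * s%:C) *: emb e = tilt e (t + s) x.
Proof. by rewrite /tilt -addrA -scalerDl -mulrDr -rmorphD. Qed.

Lemma tilt_side e t (s : R) x : tilt e t x + s%:C *: emb e = tilt e t (x + s *: e).
Proof. by rewrite /tilt addrAC -embZ -embD. Qed.

Lemma tilt0 e x : tilt e 0 x = emb x.
Proof. by rewrite /tilt mulr0 scale0r addr0. Qed.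

Lemma tiltE e t x : tilt e t x = emb x + ('i * t%:C) *: emb e.
Proof. by []. Qed.

Opaque tilt.

Lemma strip_local_bounds (e : 'rV[R]_d) (T : R) : (forall j, `|e 0 j| <= 1) -> 0 < T < h ->
  exists C : R, forall t x, 0 <= t <= T -> (forall j, 0 <= x 0 j <= 1) ->
    local_bounds setT f C (tilt e t x).
Proof.
move=> e1 /andP[T0 Th].
pose z (p : 'rV[R]_d.+1) : 'rV[R[i]]_d :=
  tilt e (T * p 0 ord0) (\row_j p 0 (lift ord0 j)).
have [|||C hC] := @local_bounds_uniform R d setT f d.+1 z (1 + T).
- by rewrite addr_gt0.
- move=> p q a qp j.
  have zE r : z r 0 j = (r 0 (lift ord0 j))%:C + 'i * (T * r 0 ord0 * e 0 j)%:C.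
    by apply: eq_trans (tilt_coord _ _ _ _) _; rewrite [X in X%:C + _]mxE.
  have diff (a1 a2 b1 b2 c : R) : a1%:C + 'i * (T * a2 * c)%:C -
      (b1%:C + 'i * (T * b2 * c)%:C) =
      (a1 - b1)%:C + 'i * (T * (a2 - b2) * c)%:C :> R[i].
    have -> : T * (a2 - b2) * c = T * a2 * c - T * b2 * c by ring.
    by rewrite !rmorphB mulrBr /=; ring.
  have -> : z q 0 j - z p 0 j = (q 0 (lift ord0 j) - p 0 (lift ord0 j))%:C +
      'i * (T * (q 0 ord0 - p 0 ord0) * e 0 j)%:C.
    by apply: eq_trans (diff _ _ _ _ _); congr (_ - _).
  rewrite (le_trans (nmD _ _))// nmM nmi mul1r !nmC mulrDl mul1r.
  apply: lerD; first by rewrite ltW.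
  rewrite !normrM (gtr0_norm T0) -mulrA ler_wpM2l ?(ltW T0)//.
  by rewrite (le_trans (ler_piMr _ (e1 j)))// ltW.
- move=> p p01; split=> //; apply: has_series_complex; apply: f_analytic.
  apply: tilt_strip => //; have /andP[p0 p1] := p01 ord0.
  rewrite normrM (gtr0_norm T0) ger0_norm//; apply: le_lt_trans Th.
  by rewrite ler_piMr// ltW.
exists C => t x /andP[t0 tT] x01.
have := hC (row_mx ((t / T)%:M : 'rV_1) x : 'rV_d.+1).
have -> : z (row_mx ((t / T)%:M : 'rV_1) x : 'rV_d.+1) = tilt e t x.
  rewrite /z slice_coord0 mulrC divfK ?lt0r_neq0//; congr tilt.
  by apply/rowP => j; rewrite mxE slice_coordS.
apply=> j; case: (unliftP ord0 j) => [i ->|->]; rewrite ?slice_coordS ?slice_coord0//.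
by rewrite divr_ge0 ?(ltW T0)//= ler_pdivrMr// mul1r.
Qed.

Lemma regular_tilt e t : (forall j, `|e 0 j| <= 1) -> 0 <= t < h ->
  regular (fun x => f (tilt e t x)).
Proof.
move=> e1 /andP[t0 th]; pose T := (t + h) / 2.
have tT : 0 <= t <= T by rewrite t0 /T /=; lra.
have Th : 0 < T < h by rewrite /T; lra.
have [C hC] := strip_local_bounds e1 Th.
apply: (@regular_of_local_bounds R d setT f (('i * t%:C) *: emb e) C) => //.
- move=> x k; rewrite tilt_zvec f_periodic//; apply: tilt_strip => //.
  by rewrite ger0_norm.
- by move=> x x01; rewrite -tiltE; exact: hC.
Qed.

Lemma strip_CR (e : 'rV[R]_d) (T : R) : (forall j, `|e 0 j| <= 1) -> 0 < T < h ->
  exists2 C : R, 0 <= C & forall t s x, 0 <= t -> 0 <= s -> t + s <= T -> C * s <= 1 ->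
    nm (f (tilt e (t + s) x) - f (tilt e t x) -
        'i * (f (tilt e t (x + s *: e)) - f (tilt e t x))) <= C * s ^+ 2.
Proof.
move=> e1 Th; have [C hC] := strip_local_bounds e1 Th.
exists (Num.max C 0); first by rewrite le_max lexx orbT.
move=> t s x t0 s0 ts Cs; have /andP[T0 Th'] := Th.
have str r y : 0 <= r <= T -> strip h (tilt e r y).
  move=> /andP[r0 rT]; apply: tilt_strip => //.
  by rewrite ger0_norm//; apply: le_lt_trans Th'.
have tT : 0 <= t <= T by rewrite t0 /=; lra.
have tsT : 0 <= t + s <= T by rewrite ts addr_ge0.
have [k xk] := cube_repr x.
have := local_bounds_mono (_ : C <= Num.max C 0) (hC t _ tT xk).
rewrite le_max lexx => /(_ isT)[_ _].
have e1' j : nm (emb e 0 j) <= 1 by rewrite mxE nmC.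
move=> /(_ (emb e) s e1'); rewrite ger0_norm// => /(_ Cs I I I).
rewrite tilt_up tilt_side (addrAC x).
have per r y : 0 <= r <= T -> f (tilt e r (y + zvec R k)) = f (tilt e r y).
  by move=> rT; rewrite tilt_zvec (f_periodic (str r y rT)).
move=> bnd; apply: (eq_ind _ (fun z => nm z <= Num.max C 0 * s ^+ 2) bnd).
by congr (_ - _ - 'i * (_ - _)); exact: per.
Qed.

End Strip.

Section Decay.
Variable R : realType.

(** Cutting [0, T] into [N] equal steps bounds the total increment by
    [N * D * (T / N)^2], which tends to zero. *)
Lemma second_order_const (p : R -> R[i]) (T C D : R) : 0 < T -> 0 <= C -> 0 <= D ->
  (forall t s, 0 <= t -> 0 <= s -> t + s <= T -> C * s <= 1 ->
     nm (p (t + s) - p t) <= D * s ^+ 2) -> p T = p 0.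
Proof.
move=> T0 C0 D0 hp; apply/eqP; rewrite -subr_eq0 -nm_eq0; apply/negPn/negP => n0.
have b0 : 0 < nm (p T - p 0) by rewrite lt_def n0 nm_ge0.
set b := nm _ in b0.
pose z := C * T + D * T ^+ 2 / b.
have u1 : 0 <= C * T by rewrite mulr_ge0// ltW.
have u2 : 0 <= D * T ^+ 2 / b by rewrite divr_ge0 ?mulr_ge0 ?sqr_ge0// ltW.
have z0 : 0 <= z by rewrite addr_ge0.
pose N := (Num.trunc z).+1.
have zN : z < N%:R by have /andP[_] := truncn_itv z0.
have N0 : 0 < N%:R :> R by rewrite ltr0n.
pose s := T / N%:R; have s0 : 0 < s by rewrite divr_gt0.
have Cs : C * s <= 1 by rewrite /s mulrA ler_pdivrMr// mul1r; rewrite /z in zN; lra.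
have step k : (k <= N)%N -> nm (p (k%:R * s) - p 0) <= k%:R * (D * s ^+ 2).
  elim: k => [|k IH] kN; first by rewrite !mul0r subrr nm0.
  have := hp (k%:R * s) s; rewrite mulr_ge0 ?(ltW s0)//.
  have -> : k%:R * s + s = k.+1%:R * s by rewrite -natr1 mulrDl mul1r.
  have -> : k.+1%:R * s <= T.
    by rewrite /s mulrA ler_pdivrMr// mulrC ler_wpM2l ?(ltW T0)// ler_nat.
  move=> /(_ isT isT isT Cs) h1; have h2 := IH (ltnW kN).
  rewrite (le_trans (nm_tri _ (p (k%:R * s)) _))//.
  have -> : k.+1%:R * (D * s ^+ 2) = D * s ^+ 2 + k%:R * (D * s ^+ 2).
    by rewrite -natr1; ring.
  exact: lerD.
have := step N (leqnn N).
have -> : N%:R * s = T by rewrite /s mulrC divfK// lt0r_neq0.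
rewrite -/b leNgt => /negP; apply.
have -> : N%:R * (D * s ^+ 2) = D * T ^+ 2 / N%:R.
  by rewrite /s; field; rewrite lt0r_neq0.
rewrite ltr_pdivrMr// -ltr_pdivrMl// mulrC.
by apply: le_lt_trans zN; rewrite /z lerDr.
Qed.

Lemma exp_trig_approx (b : R) : 0 <= b <= 1 ->
  nm ((1 + 'i * ((cos b +i* sin (- b)) - 1)) * (expR (- b))%:C - 1) <= 3 * b ^+ 2.
Proof.
move=> /andP[b0 b1]; have -> : (1 + 'i * ((cos b +i* sin (- b)) - 1)) *
    (expR (- b))%:C - 1 = ((1 + sin b) * expR (- b) - 1)%:C -
    'i * ((1 - cos b) * expR (- b))%:C.
  by rewrite sinN; apply/eqP; rewrite eq_complex /=; apply/andP; split;
    apply/eqP; ring.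
rewrite (le_trans (nmD _ _))// nmN nmM nmi mul1r !nmC.
have e0 := expR_gt0 (- b); have e1 : expR (- b) <= 1 by rewrite expR_le1 oppr_le0.
have eb : 1 - b <= expR (- b) by have := expR_ge1Dx (- b).
have eb2 : (1 + b) * expR (- b) <= 1.
  by rewrite -[leRHS](expRxMexpNx_1 b) ler_wpM2r ?(ltW e0)// expR_ge1Dx.
have := @sin_sub_le R b; rewrite ger0_norm// => /(_ b1).
rewrite ler_norml => /andP[s1 s2].
have /andP[c0 c1] := one_sub_cos_le b.
set E := expR _ in e0 e1 eb eb2 *; set sb := sin b in s1 s2 *.
have t1 : `|(1 - cos b) * E| <= b ^+ 2 / 2.
  rewrite normrM (ger0_norm c0) (gtr0_norm e0).
  by apply: le_trans c1; rewrite ler_piMr.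
have t2 : `|(b - sb) * E| <= b ^+ 2.
  rewrite normrM (gtr0_norm e0); apply: (@le_trans _ _ `|b - sb|).
    by rewrite ler_piMr.
  by rewrite ler_norml s1.
have t3 : 1 - b ^+ 2 <= (1 + b) * E.
  have -> : 1 - b ^+ 2 = (1 + b) * (1 - b) by ring.
  by rewrite ler_wpM2l// addr_ge0.
have t4 : `|(1 + sb) * E - 1| <= 2 * b ^+ 2.
  have -> : (1 + sb) * E - 1 = ((1 + b) * E - 1) - (b - sb) * E by ring.
  rewrite mulr_natl mulr2n (le_trans (ler_normB _ _))// lerD//.
  by rewrite ler_norml; apply/andP; split; lra.
lra.
Qed.

(** Transport of a Fourier coefficient along a family that satisfies the
    Cauchy-Riemann equation in the direction [e]: a real translation multiplies
    the coefficient by a character, so an imaginary one by an exponential. *)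
Lemma mean_transport d (h M : R) (n : 'rV[int]_d) (e : 'rV[R]_d)
    (g : R -> 'rV[R]_d -> R[i]) :
  0 < h -> dot n e = (norm1 n)%:R ->
  (forall t, 0 <= t < h -> regular (g t)) ->
  (forall t x, 0 <= t < h -> nm (g t x) <= M) ->
  (forall T, 0 < T < h -> exists2 C : R, 0 <= C &
     forall t s x, 0 <= t -> 0 <= s -> t + s <= T -> C * s <= 1 ->
     nm (g (t + s) x - g t x - 'i * (g t (x + s *: e) - g t x)) <= C * s ^+ 2) ->
  nm (mean (fun x => g 0 x * chi n x)) <=
    M * expR (- (2 * pi * h * (norm1 n)%:R)).
Proof.
move=> h0 en rg gM gCR.
pose k := 2 * pi * (norm1 n)%:R : R.
have k0 : 0 <= k by rewrite !mulr_ge0 ?pi_ge0.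
pose p t := mean (fun x => g t x * chi n x).
have rp t : 0 <= t < h -> regular (fun x => g t x * chi n x).
  by move=> th; apply: regularM; [exact: rg|exact: regular_chi].
have pM t : 0 <= t < h -> nm (p t) <= M.
  move=> th; apply: mean_bound; first exact: rp.
  by move=> x; rewrite nmM nm_chi mulr1; exact: gM.
have M0 : 0 <= M by apply: le_trans (nm_ge0 _) (pM 0 _); rewrite lexx h0.
have shift t s : 0 <= t < h ->
    mean (fun x => g t (x + s *: e) * chi n x) = ee (- (s * (norm1 n)%:R)) * p t.
  move=> th; rewrite -meanZ; last exact: rp.
  have r1 : regular (fun x => ee (- (s * (norm1 n)%:R)) * (g t x * chi n x)).
    by apply: regularZ; exact: rp.
  rewrite -(mean_shift (s *: e) r1); congr mean; apply/funext => x.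
  have -> : chi n (x + s *: e) = chi n x * ee (s * (norm1 n)%:R).
    by rewrite chi_shift /chi dotZr en.
  have uu : ee (- (s * (norm1 n)%:R)) * ee (s * (norm1 n)%:R) = 1 :> R[i].
    by rewrite -eeD addNr ee0.
  have alg (a b c c' : R[i]) : c * c' = 1 -> a * b = c * (a * (b * c')).
    by move=> cc; rewrite -[LHS]mulr1 -cc; ring.
  exact: alg.
have const T : 0 < T < h -> p T * (expR (- (k * T)))%:C = p 0.
  move=> /[dup] Th /andP[T0 T1]; have [C C0 hC] := gCR T Th.
  pose q t := p t * (expR (- (k * t)))%:C.
  rewrite -/(q T) (_ : p 0 = q 0); last first.
    by rewrite /q [k * 0]mulr0 oppr0 expR0 mulr1.
  have D0 : 0 <= M * (3 * k ^+ 2) + C.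
    by rewrite addr_ge0// mulr_ge0// pmulr_rge0// sqr_ge0.
  apply: (second_order_const T0 (addr_ge0 C0 k0) D0) => t s t0 s0 ts Cks.
  have Cs : C * s <= 1 by nra.
  have ks : 0 <= k * s <= 1 by rewrite mulr_ge0//=; nra.
  have th : 0 <= t < h by rewrite t0 /=; lra.
  have tsh : 0 <= t + s < h by rewrite addr_ge0//=; lra.
  have rgs : regular (fun x => g t (x + s *: e)) by apply: regular_shift; exact: rg.
  pose Err := p (t + s) - p t - 'i * (ee (- (s * (norm1 n)%:R)) * p t - p t).
  have hErr : nm Err <= C * s ^+ 2.
    have -> : Err = mean (fun x =>
        (g (t + s) x - g t x - 'i * (g t (x + s *: e) - g t x)) * chi n x).
      have -> : (fun x => (g (t + s) x - g t x -
            'i * (g t (x + s *: e) - g t x)) * chi n x) =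
          fun x => (g (t + s) x * chi n x - g t x * chi n x) -
            'i * (g t (x + s *: e) * chi n x - g t x * chi n x).
        have alg2 (a b c z : R[i]) : (a - b - 'i * (c - b)) * z =
            a * z - b * z - 'i * (c * z - b * z) by ring.
        by apply/funext => x; exact: alg2.
      have r1 := rp _ th; have r2 := rp _ tsh.
      have r3 : regular (fun x => g t (x + s *: e) * chi n x).
        by apply: regularM => //; exact: regular_chi.
      rewrite meanB; [|exact: regularB|by apply: regularZ; exact: regularB].
      rewrite meanB// meanZ; last exact: regularB.
      by rewrite meanB// (shift t s th).
    apply: mean_bound.
      apply: regularM; last exact: regular_chi.
      apply: regularB; first by apply: regularB; exact: rg.
      by apply: regularZ; apply: regularB => //; exact: rg.
    by move=> x; rewrite nmM nm_chi mulr1; exact: hC.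
  have -> : q (t + s) - q t = (expR (- (k * t)))%:C * (p t *
     ((1 + 'i * (ee (- (s * (norm1 n)%:R)) - 1)) * (expR (- (k * s)))%:C - 1) +
       Err * (expR (- (k * s)))%:C).
    rewrite /q mulrDr opprD expRD rmorphM /= /Err; ring.
  rewrite nmM nmC ger0_norm ?expR_ge0//.
  have E1 : expR (- (k * t)) <= 1 by rewrite expR_le1 oppr_le0 mulr_ge0.
  have E2 : expR (- (k * s)) <= 1 by rewrite expR_le1 oppr_le0 mulr_ge0.
  have := exp_trig_approx ks.
  have -> : cos (k * s) +i* sin (- (k * s)) = ee (- (s * (norm1 n)%:R)).
    rewrite eeE -cosN; congr (cos _ +i* sin _); rewrite /k; ring.
  move=> h3; apply: (@le_trans _ _ (1 * (M * (3 * (k * s) ^+ 2) + C * s ^+ 2 * 1))).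
    apply: ler_pM; rewrite ?expR_ge0 ?nm_ge0//.
    rewrite (le_trans (nmD _ _))// lerD// nmM; first by apply: ler_pM; rewrite ?nm_ge0 ?pM.
    by apply: ler_pM; rewrite ?nm_ge0// nmC ger0_norm ?expR_ge0.
  by rewrite mul1r mulr1 exprMn; lra.
have bnd T : 0 < T < h -> nm (p 0) <= M * expR (- (k * T)).
  move=> /[dup] Th /andP[T0 T1]; rewrite -(const T Th) nmM nmC.
  rewrite ger0_norm ?expR_ge0// ler_wpM2r ?expR_ge0// pM// T1 andbT ltW//.
rewrite -/(p 0).
have -> : 2 * pi * h * (norm1 n)%:R = k * h by rewrite /k; ring.
(* the height T tends to h *)
rewrite expRN ler_pdivlMr ?expR_gt0//.
set X := nm (p 0) * _; have X0 : 0 <= X by rewrite mulr_ge0 ?nm_ge0 ?expR_ge0.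
apply/ler_addgt0Pr => a a0; have Xk : 0 < X * k + 1.
  by apply: ltr_wpDl; [exact: mulr_ge0|exact: ltr01].
pose b := Num.min (h / 2) (a / (X * k + 1)).
have b0 : 0 < b by rewrite lt_min !divr_gt0.
have bh : b <= h / 2 by rewrite ge_min lexx.
have ba : X * k * b <= a.
  have : b <= a / (X * k + 1) by rewrite ge_min lexx orbT.
  by rewrite ler_pdivlMr//; nra.
have /bnd : 0 < h - b < h by lra.
rewrite expRN ler_pdivlMr ?expR_gt0//.
rewrite mulrBr expRD mulrA -/X => Xb.
have := expR_ge1Dx (- (k * b)) => eb.
nra.
Qed.

(** Fourier coefficients of a bounded analytic function on a strip: the torus of
    integration is moved in the direction [sgn n]. *)
Lemma fourier_decay d (h M : R) (f : 'rV[R[i]]_d -> R[i]) : 0 < h ->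
  (forall z, strip h z -> forall k, f (z + zvec R[i] k) = f z) ->
  (forall z, strip h z -> analytic_at f z) ->
  (forall z, strip h z -> nm (f z) <= M) ->
  forall n, nm (mean (fun x => f (emb x) * chi n x)) <=
    M * expR (- (2 * pi * h * (norm1 n)%:R)).
Proof.
move=> h0 fp fa fb n.
pose e : 'rV[R]_d := \row_j Num.sg (n 0 j)%:~R.
have e1 j : `|e 0 j| <= 1 by rewrite mxE normr_sg; case: eqP.
have en : dot n e = (norm1 n)%:R.
  rewrite norm1_sum; apply: eq_bigr => j _; rewrite mxE mulrC -normrEsg.
  by rewrite intr_norm.
have -> : (fun x => f (emb x) * chi n x) = fun x => f (tilt e 0 x) * chi n x.
  by apply/funext => x; rewrite tilt0.
apply: (mean_transport (g := fun t x => f (tilt e t x)) h0 en).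
- by move=> t; exact: regular_tilt fp fa _ _ e1.
- move=> t x /andP[t0 th]; apply: fb; apply: tilt_strip => //.
  by rewrite ger0_norm.
- by move=> T Th; have := strip_CR fp fa e1 Th.
Qed.

End Decay.

(** * Pairing with a square summable eigenfunction *)

Section MoreSums.
Variable R : realType.

Lemma has_sum_cauchy_real (I : choiceType) (a : I -> R) :
  (forall e : R, 0 < e -> exists J0 : {fset I}, forall J : {fset I},
     [disjoint J & J0]%fset -> `|\sum_(i <- J) a i| <= e) ->
  exists s, has_sum a s.
Proof.
move=> h; have PF : ProperFilter (partial_sum a @ @totally I).
  exact: (fmap_proper_filter _ (@totally_filter I)).
exists (lim (partial_sum a @ totally)); rewrite /has_sum.
apply/cauchy_cvgP; apply: cauchy_exP => e e0.
have [J0 hJ] := h (e / 2) (divr_gt0 e0 (ltr0Sn _ 1)).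
exists (\sum_(i <- J0) a i); exists J0 => // J /= J0J.
have pE : partial_sum a J = \sum_(i <- J) a i by rewrite big_seq_fsetE.
rewrite /ball /= pE (sum_fsetID J J0).
have -> : (J `&` J0)%fset = J0 by apply/fsetIidPr.
rewrite opprD addrA subrr add0r normrN; apply: (@le_lt_trans _ _ (e / 2)).
  by apply: hJ; apply/fdisjointP => i; rewrite !inE => /andP[].
by rewrite ltr_pdivrMr// ltr_pMr// ltr1n.
Qed.

Lemma has_sum_cauchy (I : choiceType) (a : I -> R[i]) :
  (forall e : R, 0 < e -> exists J0 : {fset I}, forall J : {fset I},
     [disjoint J & J0]%fset -> nm (\sum_(i <- J) a i) <= e) ->
  exists s, has_sum a s.
Proof.
move=> h.
have [|s hs] := @has_sum_cauchy_real I (fun i => complex.Re (a i)).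
  move=> e e0; have [J0 hJ] := h e e0; exists J0 => J /hJ; apply: le_trans.
  by rewrite -raddf_sum Re_le_nm.
have [|t ht] := @has_sum_cauchy_real I (fun i => complex.Im (a i)).
  move=> e e0; have [J0 hJ] := h e e0; exists J0 => J /hJ; apply: le_trans.
  by rewrite -raddf_sum Im_le_nm.
exists (s +i* t); apply/has_sum_nm => e e0; have e2 : 0 < e / 2 by rewrite divr_gt0.
have [J1 h1] := (has_sum_norm _ _).1 hs _ e2.
have [J2 h2] := (has_sum_norm _ _).1 ht _ e2.
exists (J1 `|` J2)%fset => J; rewrite fsubUset => /andP[/h1 k1 /h2 k2].
rewrite (le_trans (nm_le_ReIm _))// [leRHS]splitr !raddfB /= !raddf_sum.
by rewrite lerD// distrC.
Qed.

Lemma has_sum_conj (I : choiceType) (a : I -> R[i]) s : has_sum a s ->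
  has_sum (fun i => conjc (a i)) (conjc s).
Proof.
move=> /has_sum_nm h; apply/has_sum_nm => e e0; have [J0 hJ] := h e e0.
exists J0 => J /hJ; rewrite -nm_conj rmorphB rmorph_sum.
by [].
Qed.

Lemma has_sum_shift (V : zmodType) (n : V) (a : V -> R[i]) s : has_sum a s ->
  has_sum (fun k => a (n + k)) s.
Proof.
move=> /has_sum_nm h; apply/has_sum_nm => e e0; have [J0 hJ] := h e e0.
exists [fset (k - n)%R | k in J0]%fset => J sJ.
have inj : {in J &, injective (fun k => n + k)} by move=> x y _ _; exact: addrI.
have := hJ [fset (n + k)%R | k in J]%fset; rewrite big_imfset//; apply.
apply/fsubsetP => k kJ; apply/imfsetP; exists (k - n) => /=; last first.
  by rewrite addrC subrK.
by apply: (fsubsetP sJ); apply/imfsetP; exists k.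
Qed.

Lemma has_sum_single (I : choiceType) (a : I -> R[i]) (m : I) :
  (forall i, i != m -> a i = 0) -> has_sum a (a m).
Proof.
move=> am; apply/has_sum_nm => e e0; exists [fset m]%fset => J mJ.
rewrite (big_fsetD1 m)/=; last by rewrite -fsub1set.
rewrite big1_fset => [|i]; first by rewrite addr0 subrr nm0 ltW.
by rewrite !inE => /andP[im _] _; exact: am.
Qed.

Lemma has_sum_dist (I : choiceType) (a : I -> R[i]) s (J : {fset I}) (B : R) :
  has_sum a s ->
  (forall J' : {fset I}, (J `<=` J')%fset -> nm (\sum_(i <- (J' `\` J)%fset) a i) <= B) ->
  nm (s - \sum_(i <- J) a i) <= B.
Proof.
move=> /has_sum_nm h hB; apply/ler_addgt0Pr => e e0; have [J0 hJ] := h e e0.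
have := hB (J `|` J0)%fset (fsubsetUl _ _).
have := hJ (J `|` J0)%fset (fsubsetUr _ _).
rewrite (sum_fsetID (J `|` J0)%fset J).
have -> : ((J `|` J0) `&` J)%fset = J by apply/fsetIidPr; exact: fsubsetUl.
set T := \sum_(i <- (_ `\` _)%fset) _; set U := \sum_(i <- J) a i => h1 h2.
have -> : s - U = T - (U + T - s) by ring.
by rewrite (le_trans (nmD _ _))// nmN lerD.
Qed.

End MoreSums.

Lemma conjM (R : realType) (a b : R[i]) : conjc (a * b) = conjc a * conjc b.
Proof. exact: rmorphM. Qed.

Lemma conjD (R : realType) (a b : R[i]) : conjc (a + b) = conjc a + conjc b.
Proof. exact: rmorphD. Qed.

Lemma conjR (R : realType) (a : R) : conjc (a%:C : R[i]) = a%:C.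
Proof. exact: conjc_real. Qed.

Section Pairing.
Variables (R : realType) (d : nat).
Implicit Types (f g : 'rV[R]_d -> R[i]) (x : 'rV[R]_d) (n m k : 'rV[int]_d).

Lemma mean_conj f : regular f -> mean (fun x => conjc (f x)) = conjc (mean f).
Proof.
move=> rf; have [_ cZ _ _] := cube_rules R d.
have ReJ x : complex.Re (conjc (f x)) = complex.Re (f x) by case: (f x).
have ImJ x : complex.Im (conjc (f x)) = -1 * complex.Im (f x).
  by case: (f x) => a b /=; rewrite mulN1r.
rewrite /mean (funext ReJ) (funext ImJ) cZ; last exact: regular_Im.
by rewrite mulN1r.
Qed.

(** Cauchy-Schwarz in its weighted arithmetic-geometric form: the free weight
    [t] is tuned by each application, and no square root appears. *)
Lemma mean_mul_le f g (t : R) : regular f -> regular g -> 0 < t ->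
  nm (mean (fun x => f x * g x)) <=
    t * complex.Re (mean (fun x => g x * conjc (g x))) +
    complex.Re (mean (fun x => f x * conjc (f x))) / t.
Proof.
move=> rf rg t0.
have rff : regular (fun x => f x * conjc (f x)).
  by apply: regularM => //; exact: regular_conj.
have rgg : regular (fun x => g x * conjc (g x)).
  by apply: regularM => //; exact: regular_conj.
pose G x := t%:C * (g x * conjc (g x)) + (t^-1)%:C * (f x * conjc (f x)).
have rG : regular G by apply: regularD; exact: regularZ.
have -> : t * complex.Re (mean (fun x => g x * conjc (g x))) +
    complex.Re (mean (fun x => f x * conjc (f x))) / t = complex.Re (mean G).
  rewrite meanD; [|exact: regularZ..]; rewrite !meanZ//.
  by move: (mean _) (mean _) => [a1 b1] [a2 b2] /=; ring.
apply: mean_le => // [|x]; first exact: regularM.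
rewrite /G !mul_conj nmM /= !mul0r !subr0.
have f0 := nm_ge0 (f x); have g0 := nm_ge0 (g x).
set F := nm (f x) in f0 *; set H := nm (g x) in g0 *.
have ti : 0 < t^-1 by rewrite invr_gt0.
have tt : t * t^-1 = 1 by rewrite divff// lt0r_neq0.
have : 0 <= t^-1 * (F - t * H) ^+ 2 by rewrite mulr_ge0 ?sqr_ge0// ltW.
have -> : t^-1 * (F - t * H) ^+ 2 =
   t^-1 * F ^+ 2 - 2 * (t * t^-1) * (F * H) + t * (t * t^-1) * H ^+ 2 by ring.
rewrite tt; have : 0 <= F * H by rewrite mulr_ge0.
lra.
Qed.

Variable u : 'rV[int]_d -> R[i].

Definition mass (J : {fset 'rV[int]_d}) : R := \sum_(n <- J) nm (u n) ^+ 2.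

Definition fourier_sum (J : {fset 'rV[int]_d}) x : R[i] :=
  \sum_(n <- J) conjc (u n) * chi n x.

Lemma regular_fourier_sum J : regular (fourier_sum J).
Proof. by apply: regular_sum => n; apply: regularZ; exact: regular_chi. Qed.

Lemma conj_fourier_sum J x : conjc (fourier_sum J x) = \sum_(n <- J) u n * chi (- n) x.
Proof.
rewrite /fourier_sum rmorph_sum; apply: eq_bigr => n _.
by rewrite rmorphM /= conjcK chiN.
Qed.

Lemma mean_mul_fourier_sum f J : regular f -> mean (fun x => f x * fourier_sum J x) =
  \sum_(n <- J) conjc (u n) * mean (fun x => f x * chi n x).
Proof.
move=> rf; have rc n : regular (fun x => f x * chi n x).
  by apply: regularM => //; exact: regular_chi.
have -> : (fun x => f x * fourier_sum J x) =
    fun x => \sum_(n <- J) conjc (u n) * (f x * chi n x).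
  by apply/funext => x; rewrite mulr_sumr; apply: eq_bigr => n _; rewrite mulrCA.
rewrite mean_sum => [|n]; last exact: regularZ.
by apply: eq_bigr => n _; rewrite meanZ.
Qed.

(** Parseval for a finite Fourier sum. *)
Lemma mean_fourier_sum_sqr J :
  mean (fun x => fourier_sum J x * conjc (fourier_sum J x)) = (mass J)%:C.
Proof.
have -> : (fun x => fourier_sum J x * conjc (fourier_sum J x)) =
    fun x => conjc (fourier_sum J x) * fourier_sum J x by apply/funext => x; rewrite mulrC.
rewrite mean_mul_fourier_sum; last by apply: regular_conj; exact: regular_fourier_sum.
rewrite /mass rmorph_sum; apply: eq_big_seq => n nJ /=.
have -> : (fun x => conjc (fourier_sum J x) * chi n x) =
    fun x => \sum_(m <- J) u m * chi (n - m) x.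
  apply/funext => x; rewrite conj_fourier_sum mulr_suml; apply: eq_bigr => m _.
  by rewrite -mulrA -chiD addrC.
rewrite mean_sum => [|m]; last by apply: regularZ; exact: regular_chi.
rewrite (big_fsetD1 n)//= big1_fset => [|m]; last first.
  rewrite !inE => /andP[mn _] _; rewrite meanZ; last exact: regular_chi.
  by rewrite mean_chi subr_eq0 eq_sym (negbTE mn) mulr0.
rewrite addr0 meanZ; last exact: regular_chi.
by rewrite mean_chi subrr eqxx mulr1 mulrC mul_conj.
Qed.

Hypothesis u2 : ell2 u.

Lemma mass_bounded : exists2 s : R, 0 <= s & forall J, mass J <= s.
Proof.
have nmE n : complex.Re (`|u n| ^+ 2) = nm (u n) ^+ 2.
  by rewrite normr_nm -rmorphXn.
move: u2; rewrite /ell2; set s := esum _ _ => sfin.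
have le J : ((mass J)%:E <= s)%E.
  apply: esum_ge; exists [set` J]; first by split.
  rewrite -fsbig_seq ?fset_uniq//.
  by rewrite /mass -sumEFin; apply: lee_sum => n _; rewrite nmE.
have s0 : (0 <= s)%E.
  by apply: le_trans (le fset0); rewrite /mass big_seq_fset0.
have fs : s \is a fin_num by rewrite ge0_fin_numE.
exists (fine s); first exact: fine_ge0.
by move=> J; rewrite -lee_fin fineK.
Qed.

Lemma mass_ge0 J : 0 <= mass J.
Proof. by apply: sumr_ge0 => n _; rewrite sqr_ge0. Qed.

Lemma mass_tail (e : R) : 0 < e -> exists J0 : {fset 'rV[int]_d}, forall J,
  [disjoint J & J0]%fset -> mass J <= e.
Proof.
move=> e0; have [s s0 hs] := mass_bounded.
pose A := [set mass J | J in setT].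
have hA : has_sup A.
  by split; [exists (mass fset0), fset0|exists s => _ [J _ <-]].
have [_ [J0 _ <-] hJ0] := sup_adherent e0 hA; exists J0 => J dJ.
have : mass (J `|` J0)%fset <= sup A by apply: sup_upper_bound => //; exists (J `|` J0)%fset.
by rewrite /mass sum_fsetU// -!/(mass _); lra.
Qed.

(** The integral of [f] against the square integrable function
    [sum_n conj (u n) chi n], the conjugate of the Fourier transform of [u]. *)
Definition pairing f : R[i] :=
  tsum (fun n => conjc (u n) * mean (fun x => f x * chi n x)).

Lemma fourier_sum_le f (J : {fset 'rV[int]_d}) (t F : R) : regular f -> 0 < t ->
  complex.Re (mean (fun x => f x * conjc (f x))) <= F ->
  nm (\sum_(n <- J) conjc (u n) * mean (fun x => f x * chi n x)) <=
    t * mass J + F / t.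
Proof.
move=> rf t0 hF; rewrite -mean_mul_fourier_sum//.
apply: le_trans (mean_mul_le rf (regular_fourier_sum J) t0) _.
by rewrite mean_fourier_sum_sqr /= lerD2l ler_wpM2r// invr_ge0 ltW.
Qed.

(** The tails are small by Cauchy-Schwarz, so the pairing converges for every
    regular [f] and not only for those with summable coefficients. *)
Lemma pairing_sum f : regular f ->
  has_sum (fun n => conjc (u n) * mean (fun x => f x * chi n x)) (pairing f).
Proof.
move=> rf; suff [s hs] : exists s, has_sum (fun n => conjc (u n) *
    mean (fun x => f x * chi n x)) s by rewrite /pairing (tsumE hs).
apply: has_sum_cauchy => e e0.
pose F := complex.Re (mean (fun x => f x * conjc (f x))).
have F0 : 0 <= F.
  have := mean_le (f := fun=> 0) (regular_cst d 0) (regularM rf (regular_conj rf)).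
  by rewrite mean_cst nm0; apply => x; rewrite mul_conj /= sqr_ge0.
have F1 : 0 < F + 1 by rewrite ltr_wpDl.
pose t := 2 * (F + 1) / e; have t0 : 0 < t by rewrite divr_gt0// mulr_gt0.
have [J0 hJ] := mass_tail (divr_gt0 (divr_gt0 e0 (ltr0Sn _ 1)) t0).
exists J0 => J /hJ mJ; apply: (le_trans (fourier_sum_le J rf t0 (lexx _))).
rewrite [leRHS]splitr lerD//.
  by rewrite mulrC -ler_pdivlMr.
rewrite -/F ler_pdivrMr// /t.
have -> : e / 2 * (2 * (F + 1) / e) = F + 1 by field; rewrite lt0r_neq0.
by rewrite lerDl.
Qed.

Lemma bfun_pairing : bfun pairing.
Proof.
have rc f n : regular f -> regular (fun x => f x * chi n x).
  by move=> rf; apply: regularM => //; exact: regular_chi.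
split.
- move=> f g rf rg; apply: tsumE.
  have := has_sumD (pairing_sum rf) (pairing_sum rg).
  congr has_sum; apply/funext => n; rewrite -mulrDr -meanD; [|exact: rc..].
  by congr (_ * mean _); apply/funext => x; rewrite mulrDl.
- move=> c f rf; apply: tsumE.
  have := @has_sumZ _ _ c _ _ (pairing_sum rf).
  congr has_sum; apply/funext => n; rewrite mulrCA -(meanZ c (rc _ n rf)).
  by congr (_ * mean _); apply/funext => x; rewrite mulrA.
- have [s s0 hs] := mass_bounded; exists (s + 1); first by rewrite addr_ge0 ?ler01.
  move=> f e rf e0 fe; apply/ler_addgt0Pr => a a0.
  have s1 : 0 < s + 1 by rewrite ltr_wpDl.
  pose t := e + a / (s + 1); have t0 : 0 < t by rewrite ltr_wpDl// divr_gt0.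
  have -> : (s + 1) * e + a = t * (s + 1).
    by rewrite /t [RHS]mulrDl divfK ?lt0r_neq0// [e * _]mulrC.
  have ff : complex.Re (mean (fun x => f x * conjc (f x))) <= t ^+ 2.
    apply: le_trans (ler_norm _) _; apply: le_trans (Re_le_nm _) _.
    apply: mean_bound; first by apply: regularM => //; exact: regular_conj.
    move=> x; rewrite nmM nm_conj -expr2 lerXn2r ?nnegrE ?nm_ge0 ?(ltW t0)//.
    by rewrite (le_trans (fe x))// lerDl divr_ge0// ltW.
  apply: (has_sum_le (pairing_sum rf)) => J.
  apply: (le_trans (fourier_sum_le J rf t0 ff)).
  rewrite mulrDr mulr1 expr2 mulfK ?lt0r_neq0// lerD2r ler_wpM2l ?(ltW t0)//.
Qed.

Lemma pairing_chi n : pairing (chi (- n)) = conjc (u n).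
Proof.
apply: tsumE.
have term k : conjc (u k) * mean (fun x => chi (- n) x * chi k x) =
    if k == n then conjc (u n) else 0.
  have -> : (fun x => chi (- n) x * chi k x) = chi (k - n).
    by apply/funext => x; rewrite mulrC -chiD.
  rewrite mean_chi subr_eq0; case: eqP => [->|_]; first by rewrite mulr1.
  by rewrite mulr0.
rewrite (funext term).
have := @has_sum_single R _ (fun k => if k == n then conjc (u n) else 0) n.
by rewrite eqxx; apply => k /negbTE ->.
Qed.

End Pairing.

Section Eigenfunction.
Variables (R : realType) (d : nat) (v : R -> R) (eps : R) (w : 'rV[R]_d -> R).
Variables (alpha : 'rV[R]_d) (x0 : R) (E : R[i]) (u : 'rV[int]_d -> R[i]).
Hypothesis rw : regular (fun x => (w x)%:C).
Hypothesis eu : eigenfunction v eps w alpha x0 E u.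

Let u2 : ell2 u. Proof. by case: eu. Qed.

Lemma fourier_coefE k :
  fourier_coef w k = mean (fun x => (w x)%:C * chi (- k) x).
Proof.
have -> : (fun x => (w x)%:C * chi (- k) x) =
    fun x => (w x)%:C * e2pi (- (dot k x)%:C).
  by apply/funext => x; rewrite /chi dotNl /ee rmorphN.
by [].
Qed.

Lemma conj_fourier_coef k :
  conjc (fourier_coef w k) = mean (fun x => (w x)%:C * chi k x).
Proof.
rewrite fourier_coefE -mean_conj; last by apply: regularM => //; exact: regular_chi.
congr mean; apply/funext => x.
by rewrite conjM conjR -chiN opprK.
Qed.

(** The convolution on the lattice is multiplication by [w] on the torus. *)
Lemma convolution_pairing n :
  tsum (fun k => fourier_coef w k * u (n + k)) =
  conjc (pairing u (fun x => (w x)%:C * chi (- n) x)).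
Proof.
apply: tsumE.
have -> : (fun k => fourier_coef w k * u (n + k)) =
    fun k => conjc (conjc (fourier_coef w k * u (n + k))).
  by apply/funext => k; rewrite conjcK.
apply: has_sum_conj.
have rn : regular (fun x => (w x)%:C * chi (- n) x).
  by apply: regularM => //; exact: regular_chi.
have := has_sum_shift n (pairing_sum u2 rn).
congr has_sum; apply/funext => k; rewrite conjM conj_fourier_coef mulrC.
congr (mean _ * _); apply/funext => x.
by rewrite -mulrA -chiD addrA addNr add0r.
Qed.

Lemma eigen_pairing n :
  eps%:C * pairing u (fun x => (w x)%:C * chi (- n) x) +
  (v (x0 + dot n alpha))%:C * pairing u (chi (- n)) =
  conjc E * pairing u (chi (- n)).
Proof.
rewrite !pairing_chi// -conjM; have [_ <-] := eu; rewrite /Hop.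
rewrite convolution_pairing conjD !conjM !conjR conjcK.
by [].
Qed.

(** Pairing the equation with a truncation of the eigenfunction: the potential
    contributes a real number, and so does the convolution by [w], up to the
    tail of [u]. *)
Lemma eigenvalue_real : (exists n, u n != 0) -> conjc E = E.
Proof.
move=> [n0 un0]; have [A hA] : exists A : R, forall x, nm ((w x)%:C : R[i]) <= A.
  by case: rw.
have A0 : 0 <= A := le_trans (nm_ge0 _) (hA 0).
have [s s0 hs] := mass_bounded u2.
have c0 : 0 < nm (u n0) ^+ 2 by rewrite exprn_gt0// lt_def nm_eq0 un0 nm_ge0.
suff Im0 : complex.Im (conjc E) = 0.
  by case: E Im0 => a b /= /eqP; rewrite oppr_eq0 => /eqP ->; rewrite oppr0.
apply/eqP; rewrite -normr_eq0 -(mulrI_eq0 _ (mulfI (lt0r_neq0 c0))).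
rewrite eq_le mulr_ge0 ?sqr_ge0// andbT.
apply/ler_addgt0Pr => e e0; rewrite add0r.
have eps1 : 0 < `|eps| + 1 by rewrite ltr_wpDl.
pose a := e / 2 / (`|eps| + 1); have a0 : 0 < a by rewrite !divr_gt0.
have F0 : 0 < A ^+ 2 * s + 1 by rewrite ltr_wpDl// mulr_ge0// sqr_ge0.
pose t := (A ^+ 2 * s + 1) / a; have t0 : 0 < t by rewrite divr_gt0.
have [J0 hJ0] := mass_tail u2 (divr_gt0 a0 t0).
pose J := (n0 |` J0)%fset.
pose f x := (w x)%:C * conjc (fourier_sum u J x).
have rf : regular f.
  by apply: regularM => //; apply: regular_conj; exact: regular_fourier_sum.
have fE : pairing u f =
    \sum_(n <- J) u n * pairing u (fun x => (w x)%:C * chi (- n) x).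
  have -> : f = fun x => \sum_(n <- J) u n * ((w x)%:C * chi (- n) x).
    apply/funext => x; rewrite /f conj_fourier_sum mulr_sumr.
    by apply: eq_bigr => n _; rewrite mulrCA.
  have bp := bfun_pairing u2; have [_ bZ _] := bp.
  have rn n : regular (fun x => (w x)%:C * chi (- n) x).
    by apply: regularM => //; exact: regular_chi.
  rewrite (@bfun_sum_fun _ _ (pairing u))//; last by move=> n; exact: regularZ.
  by apply: eq_bigr => n _; rewrite bZ.
have sumE : eps%:C * pairing u f +
    (\sum_(n <- J) v (x0 + dot n alpha) * nm (u n) ^+ 2)%:C =
    conjc E * (mass u J)%:C.
  rewrite fE /mass !rmorph_sum !mulr_sumr -big_split; apply: eq_bigr => n _ /=.
  rewrite rmorphM /= -!mul_conj -!(pairing_chi u).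
  have := congr1 ( *%R (u n)) (eigen_pairing n); rewrite mulrDr => h.
  by rewrite [RHS]mulrCA -h; ring.
have ImM : complex.Im (mean (fun x => f x * fourier_sum u J x)) = 0.
  have rft : regular (fun x => f x * fourier_sum u J x).
    by apply: regularM => //; exact: regular_fourier_sum.
  have := mean_conj rft.
  have -> : (fun x => conjc (f x * fourier_sum u J x)) = fun x => f x * fourier_sum u J x.
    apply/funext => x; rewrite /f !conjM conjR conjcK.
    by rewrite -!mulrA [fourier_sum _ _ _ * _]mulrC.
  by case: (mean _) => p q [] /= /eqP; rewrite -subr_eq0 opprK -mulr2n mulrn_eq0 /= => /eqP.
have dist : nm (pairing u f - mean (fun x => f x * fourier_sum u J x)) <= a + a.
  rewrite mean_mul_fourier_sum//; apply: (has_sum_dist (pairing_sum u2 rf)) => J' JJ'.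
  have ff : complex.Re (mean (fun x => f x * conjc (f x))) <= A ^+ 2 * s.
    pose G x := (A ^+ 2)%:C * (fourier_sum u J x * conjc (fourier_sum u J x)).
    have rtt : regular (fun x => fourier_sum u J x * conjc (fourier_sum u J x)).
      apply: regularM; first exact: regular_fourier_sum.
      by apply: regular_conj; exact: regular_fourier_sum.
    have rG : regular G by exact: regularZ.
    apply: (@le_trans _ _ (complex.Re (mean G))); last first.
      rewrite meanZ// mean_fourier_sum_sqr -rmorphM /=.
      by rewrite ler_wpM2l ?sqr_ge0.
    apply: le_trans (ler_norm _) _; apply: le_trans (Re_le_nm _) _.
    apply: mean_le => // [|x].
      by apply: regularM => //; exact: regular_conj.
    rewrite /G !mul_conj -rmorphM /= nmC ger0_norm ?sqr_ge0// /f nmM nm_conj exprMn.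
    by rewrite ler_wpM2r ?sqr_ge0// lerXn2r ?nnegrE ?nm_ge0.
  apply: (le_trans (fourier_sum_le u (J' `\` J)%fset rf t0 ff)).
  apply: lerD.
    rewrite mulrC -ler_pdivlMr//; apply: hJ0; apply/fdisjointP => n.
    by rewrite !inE negb_or -andbA => /and3P[].
  rewrite ler_pdivrMr// /t [leRHS]mulrC divfK ?lt0r_neq0//.
  by rewrite lerDl.
have mJ : nm (u n0) ^+ 2 <= mass u J.
  rewrite /mass (big_fsetD1 n0)/=; last by rewrite !inE eqxx.
  by rewrite lerDl; apply: sumr_ge0 => n _; rewrite sqr_ge0.
have ImE : complex.Im (conjc E) * mass u J = eps * complex.Im (pairing u f).
  have := congr1 (@complex.Im R) sumE; move: (conjc E) (pairing u f) => [a1 b1] [a2 b2] /=.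
  by rewrite !mul0r !mulr0 !addr0 add0r => <-.
have Imf : `|complex.Im (pairing u f)| <= a + a.
  rewrite -[complex.Im _]subr0 -ImM -raddfB.
  exact: le_trans (Im_le_nm _) dist.
apply: (@le_trans _ _ (`|complex.Im (conjc E)| * mass u J)).
  by rewrite mulrC ler_wpM2l.
rewrite -[mass u J]ger0_norm ?mass_ge0// -normrM ImE normrM.
apply: (@le_trans _ _ ((`|eps| + 1) * (a + a))).
  by apply: ler_pM => //; rewrite lerDl.
have -> : (`|eps| + 1) * (a + a) = e.
  by rewrite /a; field; rewrite lt0r_neq0.
exact: lexx.
Qed.

End Eigenfunction.

(** * The dual cocycle in the diagonalising frame *)

Lemma center_lt l : (0 < l)%N -> (l.-1 < 2 * l)%N.
Proof. lia. Qed.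

Section Cocycle.
Variables (R : realType) (d l : nat) (eps : R) (alpha : 'rV[R]_d).
Variables (v : R -> R) (vc : int -> R[i]) (w : 'rV[R]_d -> R) (E : R[i]).
Variables (B : 'rV[R]_d -> 'M[R[i]]_(2 * l)) (rho : 'I_(2 * l) -> R[i]) (x0 : R).
Variable u : 'rV[int]_d -> R[i].
Hypothesis l0 : (0 < l)%N.
Hypothesis irr : irrational_vec alpha.
Hypothesis hv : forall t : R, (v t)%:C = trig_poly l vc t.
Hypothesis vl : vc l%:Z != 0.
Hypothesis rw : regular (fun x => (w x)%:C).
Hypothesis Ereal : conjc E = E.
Hypothesis eu : eigenfunction v eps w alpha x0 E u.
Hypothesis rB : forall i j, regular (fun x => B x i j).
Hypothesis uB : forall x, B x \in unitmx.
Hypothesis hred : forall x, invmx (B (x + alpha)) *m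
  dual_cocycle l vc eps w E x *m B x = diag_mx (\row_(j < 2 * l) e2pi (rho j)).

Implicit Types (f : 'rV[R]_d -> R[i]) (n : 'rV[int]_d).

Let u2 : ell2 u. Proof. by case: eu. Qed.
Let L := pairing u.
Let bL : bfun L. Proof. exact: bfun_pairing. Qed.
Let A := dual_cocycle l vc eps w E.

Definition translate (k : int) f : 'rV[R]_d -> R[i] :=
  fun x => f (x + (- (k%:~R)) *: alpha).

(** The pairing of [f] with the translate of the eigenfunction that occupies
    the coordinate of index [k] in the solution of the dual equation. *)
Definition coordinate (k : int) f : R[i] :=
  ee (k%:~R * x0) * pairing u (translate k f).

Lemma bfun_coordinate k : bfun (coordinate k).
Proof. by apply: bfunZ; exact: (bfun_shift ((- (k%:~R)) *: alpha) bL). Qed.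

Lemma coordinate0 f : coordinate 0 f = L f.
Proof.
rewrite /coordinate mul0r ee0 mul1r; congr pairing; apply/funext => x.
by rewrite /translate oppr0 scale0r addr0.
Qed.

Lemma coordinateS k f :
  ee x0 * coordinate k (translate 1 f) = coordinate (k + 1) f.
Proof.
rewrite /coordinate mulrA -eeD; congr (ee _ * pairing u _).
  by rewrite intrD mulrDl mul1r addrC.
apply/funext => x; rewrite /translate -addrA -scalerDl.
by rewrite intrD opprD.
Qed.

Lemma translate_chi k n x :
  translate k (chi (- n)) x = ee (k%:~R * dot n alpha) * chi (- n) x.
Proof.
rewrite /translate chi_shift mulrC; congr (_ * _).
by rewrite /chi dotZr dotNl mulrNN.
Qed.

Lemma trig_polyE t :
  (v t)%:C = \sum_(j < (2 * l).+1) vc (j%:Z - l%:Z) * ee ((j%:Z - l%:Z)%:~R * t).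
Proof.
rewrite hv /trig_poly; apply: eq_bigr => j _.
by rewrite /ee rmorphM rmorph_int.
Qed.

(** The conjugate of the Fourier transform of [u] solves the dual eigenvalue
    equation in the sense of functionals: both sides agree on characters, where
    this is the eigenvalue equation on the lattice. *)
Lemma dual_equation f : regular f ->
  eps%:C * L (fun x => f x * (w x)%:C) +
    \sum_(j < (2 * l).+1) vc (j%:Z - l%:Z) * coordinate (j%:Z - l%:Z) f = E * L f.
Proof.
move=> rf; pose F f := eps%:C * L (fun x => f x * (w x)%:C) +
  \sum_(j < (2 * l).+1) vc (j%:Z - l%:Z) * coordinate (j%:Z - l%:Z) f.
have bF : bfun F.
  apply: bfunD; first by apply: bfunZ; exact: bfun_mul.
  by apply: bfun_sum => j; apply: bfunZ; exact: bfun_coordinate.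
apply: (bfun_eq bF (bfunZ E bL)) rf => m; rewrite -[m]opprK; set n := - m.
rewrite -[in RHS]Ereal -(eigen_pairing rw eu) trig_polyE mulr_suml.
congr (_ * pairing u _ + _).
  by apply/funext => x; rewrite mulrC.
apply: eq_bigr => j _; rewrite -mulrA; congr (_ * _).
rewrite mulrDr eeD -mulrA; congr (_ * _).
have [_ bZ _] := bL; rewrite -bZ; last exact: regular_chi.
by congr pairing; apply/funext => x; rewrite translate_chi.
Qed.

Definition slot (i : 'I_(2 * l)) : int := l%:Z - i.+1%:Z.

Lemma regular_cocycle i j : regular (fun x => A x i j).
Proof.
have [i0|i0] := eqVneq (i : nat) 0%N; last first.
  under eq_fun do rewrite mxE (negbTE i0); exact: regular_cst.
under eq_fun do rewrite mxE i0 eqxx.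
case: (j.+1 == l); last exact: regular_cst.
have -> : (fun x : 'rV[R]_d => (E - vc 0 - eps%:C * (w x)%:C) / vc l%:Z) =
    fun x => (vc l%:Z)^-1 * ((E - vc 0) - eps%:C * (w x)%:C).
  by apply/funext => x; rewrite mulrC.
apply: regularZ; apply: regularB; first exact: regular_cst.
exact: regularZ.
Qed.

(** The first row of the cocycle is the dual equation solved for its top term;
    the other rows shift the coordinates. *)
Lemma cocycle_equation i f : regular f ->
  \sum_j coordinate (slot j) (fun x => f x * A x i j) =
  ee x0 * coordinate (slot i) (translate 1 f).
Proof.
move=> rf; rewrite coordinateS.
have coordZ k c g : regular g ->
    coordinate k (fun x => g x * c) = coordinate k g * c.
  move=> rg; have [_ h _] := bfun_coordinate k; rewrite mulrC -h//.
  by congr coordinate; apply/funext => x; rewrite mulrC.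
have [i0|i0] := eqVneq (i : nat) 0%N; last first.
  have i1 : (i.-1 < 2 * l)%N by rewrite (leq_ltn_trans (leq_pred _)).
  have ii : i.-1.+1 = i by rewrite prednK// lt0n.
  rewrite (bigD1 (Ordinal i1))//= big1 => [|j ji].
    rewrite addr0 -[RHS]mulr1 -(_ : slot (Ordinal i1) = slot i + 1); last first.
      by rewrite /slot /= ii; lia.
    rewrite -coordZ//; congr coordinate; apply/funext => x.
    by rewrite /A mxE (negbTE i0) /= ii eqxx.
  have -> : (fun x => f x * A x i j) = fun x => f x * 0.
    apply/funext => x; rewrite /A mxE (negbTE i0).
    rewrite (_ : (i : nat) == j.+1 = false)//.
    by apply: contraNF ji => /eqP ij; apply/eqP/val_inj; rewrite /= ij.
  by rewrite coordZ// mulr0.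
have il : (l.-1 < 2 * l)%N by lia.
have AE j x : A x i j =
    (vc l%:Z)^-1 * ((if j == Ordinal il then E - eps%:C * (w x)%:C else 0)
                    - vc (slot j)).
  rewrite /A mxE i0 eqxx mulrC; congr (_ * _).
  have -> : (j.+1 == l) = (j == Ordinal il).
    by rewrite -val_eqE /=; apply/eqP/eqP; lia.
  case: eqP => [->|_]; last by rewrite sub0r.
  by rewrite /slot /= prednK// subrr addrAC.
have term j : coordinate (slot j) (fun x => f x * A x i j) = (vc l%:Z)^-1 *
    ((if j == Ordinal il then E * L f - eps%:C * L (fun x => f x * (w x)%:C) else 0)
     - vc (slot j) * coordinate (slot j) f).
  have [bD bZ _] := bfun_coordinate (slot j).
  have rfw : regular (fun x => f x * (w x)%:C) by exact: regularM.
  have -> : (fun x => f x * A x i j) = fun x => (vc l%:Z)^-1 *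
      ((if j == Ordinal il then E * f x - eps%:C * (f x * (w x)%:C) else 0)
       - vc (slot j) * f x).
    by apply/funext => x; rewrite AE; case: eqP => _; ring.
  have rZ c : regular (fun x => c * f x) by exact: regularZ.
  case: eqP => [jE|_].
    have s0 : slot j = 0 by rewrite jE /slot /= prednK// subrr.
    rewrite bZ; last by apply: regularB => //; apply: regularB => //; exact: regularZ.
    rewrite (bfunB (bfun_coordinate _))//; last by apply: regularB => //; exact: regularZ.
    rewrite bZ// s0 coordinate0 (bfunB bL)//; last exact: regularZ.
    by have [_ LZ _] := bL; rewrite LZ// LZ// coordinate0.
  have -> : (fun x => (vc l%:Z)^-1 * (0 - vc (slot j) * f x)) =
      fun x => (- (vc l%:Z)^-1 * vc (slot j)) * f x.
    by apply/funext => x; ring.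
  by rewrite bZ//; ring.
rewrite (eq_bigr _ (fun j _ => term j)) -mulr_sumr sumrB -big_mkcond big_pred1_eq.
have := dual_equation rf; rewrite big_ord_recr /=.
have -> : \sum_(j < 2 * l) vc (j%:Z - l%:Z) * coordinate (j%:Z - l%:Z) f =
    \sum_j vc (slot j) * coordinate (slot j) f.
  rewrite (reindex_inj rev_ord_inj) /=; apply: eq_bigr => j _.
  have -> : (2 * l - j.+1)%:Z - l%:Z = slot j.
    by rewrite /slot; have := ltn_ord j; lia.
  by [].
have -> : (2 * l)%:Z - l%:Z = l%:Z by lia.
have -> : slot i + 1 = l%:Z by rewrite /slot i0; lia.
set S := \sum_j _ => h.
have -> : E * L f - eps%:C * L (fun x => f x * (w x)%:C) - S =
    vc l%:Z * coordinate l%:Z f by rewrite -h; ring.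
by rewrite mulrA mulVf// mul1r.
Qed.

Let D x := invmx (B x).

Let rD i j : regular (fun x => D x i j).
Proof. exact: regular_invmx. Qed.

(** The coordinates of the dual solution in the frame that diagonalises the
    cocycle. *)
Definition reduced (j : 'I_(2 * l)) f : R[i] :=
  \sum_i coordinate (slot i) (fun x => f x * invmx (B x) j i).

Lemma bfun_reduced j : bfun (reduced j).
Proof.
by apply: bfun_sum => i; apply: bfun_mul; [exact: bfun_coordinate|exact: rD].
Qed.

Lemma reduced_frame x j i :
  \sum_k D (x + alpha) j k * A x k i = e2pi (rho j) * D x j i.
Proof.
have h : D (x + alpha) *m A x =
    diag_mx (\row_(j < 2 * l) e2pi (rho j)) *m D x.
  by rewrite -(hred x) mulmxK.
have := congr1 (fun Z : 'M[R[i]]_(2 * l) => Z j i) h.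
by rewrite mul_diag_mx !mxE.
Qed.

(** In the diagonalising frame the dual equation decouples into scalar twisted
    cohomological equations. *)
Lemma reduced_equation j f : regular f ->
  ee x0 * reduced j (translate 1 f) = e2pi (rho j) * reduced j f.
Proof.
move=> rf; rewrite /reduced mulr_sumr.
have rDa k : regular (fun x => D (x + alpha) j k).
  exact: (regular_shift alpha (rD j k)).
have step k : ee x0 * coordinate (slot k) (fun x => translate 1 f x * D x j k) =
    \sum_i coordinate (slot i) (fun x => f x * (D (x + alpha) j k * A x k i)).
  have -> : (fun x => translate 1 f x * D x j k) =
      translate 1 (fun x => f x * D (x + alpha) j k).
    apply/funext => x; rewrite /translate; congr (_ * D _ _ _).
    by rewrite scaleN1r subrK.
  rewrite -cocycle_equation; last exact: regularM.
  apply: eq_bigr => i _; congr coordinate; apply/funext => x.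
  by rewrite mulrA.
rewrite (eq_bigr _ (fun k _ => step k)) exchange_big mulr_sumr.
apply: eq_bigr => i _ /=.
have rDA k : regular (fun x => f x * (D (x + alpha) j k * A x k i)).
  by do 2! apply: regularM => //; exact: regular_cocycle.
rewrite -(bfun_sum_fun _ _ (bfun_coordinate _))//.
have [_ bZ _] := bfun_coordinate (slot i).
rewrite -bZ; last exact: regularM.
congr coordinate; apply/funext => x.
by rewrite -mulr_sumr reduced_frame mulrCA.
Qed.

(** Testing the decoupled equation on characters: a Fourier coefficient off
    resonance vanishes, and irrationality leaves at most one resonance. *)
Lemma reduced_monochromatic j : exists (c : R[i]) (k : 'rV[int]_d),
  (c != 0 -> ee (x0 + dot k alpha) = e2pi (rho j)) /\
  forall f, regular f -> reduced j f = c * mean (fun x => f x * chi k x).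
Proof.
have res n : reduced j (chi (- n)) != 0 -> ee (x0 + dot n alpha) = e2pi (rho j).
  move=> n0; have := reduced_equation j (regular_chi R (- n)).
  have -> : translate 1 (chi (- n)) = fun x => ee (dot n alpha) * chi (- n) x.
    by apply/funext => x; rewrite translate_chi mul1r.
  have [_ bZ _] := bfun_reduced j; rewrite bZ; last exact: regular_chi.
  by rewrite mulrA -eeD => /(mulIf n0).
have bM c k : bfun (fun f => c * mean (fun x => f x * chi k x)).
  by apply: bfunZ; apply: bfun_mul; [exact: bfun_mean|exact: regular_chi].
have [[n n0]|none] := pselect (exists n, reduced j (chi (- n)) != 0); last first.
  exists 0, 0; split; first by rewrite eqxx.
  move=> f rf; apply: (bfun_eq (bfun_reduced j) (bM 0 0)) rf => m.
  rewrite mul0r; apply/eqP/negPn/negP => m0; apply: none; exists (- m).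
  by rewrite opprK.
exists (reduced j (chi (- n))), n; split; first exact: res.
move=> f rf; apply: (bfun_eq (bfun_reduced j) (bM _ n)) rf => m.
have -> : (fun x => chi m x * chi n x) = @chi R d (m + n).
  by apply/funext => x; rewrite chiD.
rewrite mean_chi; have [mn|mn] := eqVneq (m + n) 0.
  by rewrite mulr1 -(addr0_eq mn) opprK.
rewrite mulr0; apply/eqP/negPn/negP; rewrite -[m]opprK => m0.
have := res _ n0; rewrite -(res _ m0) !eeD => /(mulfI (ee_neq0 _)) h.
have : ee (dot (m + n) alpha) = 1.
  by rewrite dotDl eeD h -eeD -dotDl addrN dot0l ee0.
by move/ee_eq1 => [p]; exact: irr.
Qed.

(** Going back to the original frame: the eigenfunction is a finite combination
    of shifted Fourier coefficients of one row of the conjugacy. *)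
Lemma eigenfunction_expansion :
  exists (c : 'I_(2 * l) -> R[i]) (k : 'I_(2 * l) -> 'rV[int]_d),
  (forall j, c j != 0 -> ee (x0 + dot (k j) alpha) = e2pi (rho j)) /\
  forall n, conjc (u n) =
    \sum_j c j * mean (fun x => B x (Ordinal (center_lt l0)) j * chi (k j - n) x).
Proof.
set i0 := Ordinal (center_lt l0).
have [c hc] := choice reduced_monochromatic.
have [k hk] := choice hc.
exists c, k; split=> [j|n]; first by have [] := hk j.
rewrite -(pairing_chi u) -/L -coordinate0.
have s0 : slot i0 = 0 by rewrite /slot /= prednK// subrr.
have rc := @regular_chi R d (- n).
have -> : coordinate 0 (chi (- n)) =
    \sum_j reduced j (fun x => chi (- n) x * B x i0 j).
  rewrite /reduced exchange_big /=.
  have rBD i j : regular (fun x => chi (- n) x * B x i0 j * D x j i).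
    by apply: regularM => //; exact: regularM.
  have inner i : \sum_j coordinate (slot i) (fun x => chi (- n) x * B x i0 j * D x j i) =
      (i0 == i)%:R * coordinate (slot i) (chi (- n)).
    rewrite -(bfun_sum_fun _ _ (bfun_coordinate _))//.
    have [_ bZ _] := bfun_coordinate (slot i); rewrite -bZ//.
    congr coordinate; apply/funext => x.
    under eq_bigr do rewrite -mulrA.
    rewrite -mulr_sumr mulrC; congr (_ * _).
    have := congr1 (fun Z : 'M[R[i]]_(2 * l) => Z i0 i) (mulmxV (uB x)).
    by rewrite !mxE.
  rewrite (eq_bigr _ (fun i _ => inner i)) (bigD1 i0)//= eqxx mul1r s0.
  by rewrite big1 ?addr0// => i ii; rewrite eq_sym (negbTE ii) mul0r.
apply: eq_bigr => j _; have [_ ->] := hk j; last exact: regularM.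
congr (_ * mean _); apply/funext => x.
by rewrite chiD; ring.
Qed.

End Cocycle.

(** * Resonance and exponential decay *)

Lemma norm1N d (k : 'rV[int]_d) : norm1 (- k) = norm1 k.
Proof. by rewrite /norm1; apply: eq_bigr => j _; rewrite mxE abszN. Qed.

Theorem proposition2p1 (R : realType) (d l : nat) (h eps : R)
    (alpha : 'rV[R]_d) (v : R -> R) (vc : int -> R[i]) (w : 'rV[R]_d -> R)
    (hd : (0 < d)%N) (hh : 0 < h) (heps : 0 < eps)
    (halpha : irrational_vec alpha)
    (hl : (0 < l)%N) (hv : forall t : R, (v t)%:C = trig_poly l vc t)
    (hvl : vc l%:Z != 0)
    (hw : real_analytic_torus w)
    (E : R[i]) (B : 'rV[R]_d -> 'M[R[i]]_(2 * l)) (rho : 'I_(2 * l) -> R[i])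
    (hred : diagonally_reduces h alpha (dual_cocycle l vc eps w E) B rho)
    (x : R) (hE : eigenvalue_of v eps w alpha x E) :
  (exists (j : 'I_(2 * l)) (k : 'rV[int]_d),
      (exists m : int, rho j - x%:C = (dot k alpha)%:C + m%:~R) /\
      complex.Im (rho j) = 0)
  /\
  (forall u : 'rV[int]_d -> R[i], eigenfunction v eps w alpha x E u ->
     exists C : R, forall n : 'rV[int]_d,
       `|u n| <= (C * expR (- (2 * pi * h * (norm1 n)%:R)))%:C).
Proof.
have [[Bx [Bx_real Bx_per Bx_an [M Bx_bd] Bx_unit]] red] := hred.
have real_strip (y : 'rV[R]_d) : strip h (emb y).
  by move=> j; rewrite mxE /= normr0.
have rw := regular_real_analytic hw.
have Bx_nm z i j : strip h z -> nm (Bx z i j) <= M.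
  by move=> zh; have := Bx_bd z zh i j; rewrite normr_nm le_real_complex.
have zero1 (j : 'I_d) : `|(0 : 'rV[R]_d) 0 j| <= 1 by rewrite mxE normr0.
have rB i j : regular (fun y => B y i j).
  have -> : (fun y => B y i j) = fun y => Bx (tilt 0 0 y) i j.
    by apply/funext => y; rewrite tilt0 -Bx_real.
  apply: (@regular_tilt R d h (fun z => Bx z i j)) => //.
  - by move=> z zh k; rewrite Bx_per.
  - by move=> z zh; exact: Bx_an.
  - by rewrite lexx.
have uB y : B y \in unitmx by rewrite -Bx_real; apply: Bx_unit; exact: real_strip.
have Ereal : conjc E = E by have [u [eu un0]] := hE; exact: eigenvalue_real rw eu un0.
have expand u (eu : eigenfunction v eps w alpha x E u) :=
  eigenfunction_expansion hl halpha hv hvl rw Ereal eu rB uB red.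
split.
  have [u [eu [n un0]]] := hE; have [c [k [res uE]]] := expand u eu.
  have [j cj] : exists j, c j != 0.
    apply/not_existsP => c0; move/eqP: un0; apply.
    rewrite -[u n]conjcK uE big1 ?conjc0// => j _.
    by have /negP/negPn/eqP -> := c0 j; rewrite mul0r.
  have e1 : e2pi (rho j - x%:C - (dot (k j) alpha)%:C) = 1.
    apply: (mulIf (ee_neq0 (x + dot (k j) alpha))).
    rewrite mul1r [in RHS](res j cj) /ee -e2piD; congr e2pi.
    by rewrite rmorphD /=; ring.
  have [m mE] := e2pi_eq1 e1; exists j, (k j).
  have rE : rho j - x%:C = (dot (k j) alpha)%:C + m%:~R by rewrite -mE; ring.
  split; first by exists m.
  have -> : rho j = (x + dot (k j) alpha + m%:~R)%:C.
    by rewrite !rmorphD /= rmorph_int -addrA -rE; ring.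
  by [].
move=> u eu; have [c [k [_ uE]]] := expand u eu.
have M0 : 0 <= M.
  have i0 := Ordinal (center_lt hl).
  exact: le_trans (nm_ge0 _) (Bx_nm _ i0 i0 (real_strip 0)).
exists (\sum_j nm (c j) * (M * expR (2 * pi * h * (norm1 (k j))%:R))) => n.
rewrite normr_nm le_real_complex -nm_conj uE mulr_suml (le_trans (nm_sum _ _ _))//.
apply: ler_sum => j _; rewrite nmM -[leRHS]mulrA ler_wpM2l ?nm_ge0//.
set i0 := Ordinal _.
have -> : (fun y => B y i0 j * chi (k j - n) y) =
    fun y => Bx (emb y) i0 j * chi (k j - n) y.
  by apply/funext => y; rewrite Bx_real.
have decay := @fourier_decay R d h M (fun z => Bx z i0 j) hh _ _ _ (k j - n).
apply: le_trans (decay _ _ _) _ => [z zh m|z zh|z zh|].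
- by rewrite Bx_per.
- exact: Bx_an.
- exact: Bx_nm.
have tri : (norm1 n)%:R <= (norm1 (k j - n))%:R + (norm1 (k j))%:R :> R.
  rewrite -natrD ler_nat -(norm1N (k j - n)) opprB.
  by have := norm1D (n - k j) (k j); rewrite subrK.
have q0 : 0 <= 2 * pi * h by rewrite !mulr_ge0 ?pi_ge0 ?(ltW hh).
rewrite -[leRHS]mulrA ler_wpM2l// -expRD ler_expR.
move: (2 * pi * h) q0 => q q0; have := ler_wpM2l q0 tri.
by rewrite [q * (_ + _)]mulrDr; lra.
Qed.
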